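(* For the single-phase, inexact proximal path-following algorithm described in the context, the total number of proximal Newton iterations required, in order to reach an $\varepsilon$-solution of $\min\{G(x): x\in\mathcal{X}\}$, is upper bounded by $$\mathcal{O}\left(\sqrt{\nu}\,\log\left(\frac{\nu}{\varepsilon}\right)\right).$$
   Context: **Problem.** $c\in\mathbb{R}^p$; $g:\mathbb{R}^p\to\mathbb{R}\cup\{+\infty\}$ is proper, closed and convex; $\mathcal{X}\subseteq\mathbb{R}^p$ is nonempty, closed and convex with nonempty interior $\mathrm{int}(\mathcal{X})$, and $\mathcal{X}\cap\mathrm{dom}(g)\neq\emptyset$. Put $G(x):=\langle c,x\rangle+g(x)$ and $G^\star:=\min_{x\in\mathcal{X}}G(x)$; the solution set is assumed nonempty. Given $\varepsilon>0$, a point $x$ is an $\varepsilon$-solution if $x\in\mathcal{X}$ and $G(x)-G^\star\le\varepsilon$. **Barrier.** $\mathcal{X}$ is endowed with a $\nu$-self-concordant barrier $f$ with $\mathrm{cl}(\mathrm{dom}(f))=\mathcal{X}$: $f$ is convex and three times continuously differentiable; for all $x\in\mathrm{dom}(f)$ and $v\in\mathbb{R}^p$ the function $\varphi(\tau)=f(x+\tau v)$ satisfies $|\varphi'''(\tau)|\le 2\varphi''(\tau)^{3/2}$; $\sup_u\{2\langle\nabla f(x),u\rangle-\|u\|_x^2\}\le\nu$ for all $x\in\mathrm{dom}(f)$; and $f(x)\to\infty$ as $x$ tends to the boundary of $\mathrm{dom}(f)$. For $x$ with $\nabla^2f(x)\succ0$ the local norms are $\|u\|_x:=\langle\nabla^2f(x)u,u\rangle^{1/2}$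 and $\|v\|_x^*:=\langle\nabla^2f(x)^{-1}v,v\rangle^{1/2}$. The analytical center $\bar x_f^\star:=\arg\min\{f(x):x\in\mathrm{int}(\mathcal{X})\}$ is assumed to exist. Put $n_\nu:=\nu+2\sqrt\nu$; if $f$ is a logarithmically homogeneous self-concordant barrier, then $n_\nu:=1$. **Algorithm, initialization.** Choose $\beta\in(0,1/9]$ and set $a_0:=\frac{1-\beta}{(3+\beta)n_\nu}$, $\delta:=\frac{\beta}{16}$. Find $x^0\in\mathrm{dom}(f)$ with $\|\nabla f(x^0)\|_{x^0}^*\le\kappa$ for some $\kappa\in\left(0,\frac12(2a_0+1-\sqrt{4a_0^2+1})\right)$. Compute a subgradient $\xi_0\in\partial g(x^0)$ and $c_0:=\|c+\xi_0\|_{x^0}^*$. Set $\eta:=1$, choose $t_0>\frac{(1-\beta)c_0}{(3+\beta)n_\nu}$, and put $\zeta_0:=\nabla f(x^0)+\frac1{t_0}(c+\xi_0)$. Compute $$\hat m_0:=\frac{(1-\kappa)\left(\kappa+t_0^{-1}\|c+\xi_0\|_{x^0}^*\right)}{(1-2\kappa)n_\nu},\quad \gamma_1:=\frac{(1-\hat m_0)\beta}{1-2\hat m_0}+\frac{\hat m_0}{1-\hat m_0},\quad \hat\gamma_0:=\frac{0.43\sqrt\beta(1-\hat m_0)}{1-2\hat m_0}+\frac{\hat m_0}{1-\hat m_0},$$ $$\psi_\beta(\nu):=\nu+\sqrt\nu\,\frac{\gamma_1}{1-\hat\gamma_0}+\frac{\hat\gamma_0}{(1-\hat\gamma_0)^2}(\hat\gamma_0+\gamma_1+\delta)+\frac{\delta^2}{2}+\hat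 m_0\gamma_1,$$ $$c_\beta:=\tfrac12\left[1+0.43\sqrt\beta-\sqrt{(1-0.43\sqrt\beta)^2+4\beta}\right],\qquad \sigma_\beta:=\frac{c_\beta}{(1+c_\beta)\sqrt\nu}.$$ **Algorithm, iteration.** Start with $x_{t_0}:=x^0$. For $k=0,1,\dots$: if $t_k\psi_\beta(\nu)\le\varepsilon$, terminate; otherwise set $t_{k+1}:=(1-\sigma_\beta)t_k$ and perform one inexact full-step proximal-Newton iteration, i.e. compute a $\delta$-solution $x_{t_{k+1}}\in\mathrm{int}(\mathcal{X})$ of $$\min_{x}\Big\{\langle\nabla f(x_{t_k})-\eta\zeta_0,x-x_{t_k}\rangle+\tfrac12\langle\nabla^2f(x_{t_k})(x-x_{t_k}),x-x_{t_k}\rangle+\tfrac1{t_{k+1}}G(x)\Big\},$$ meaning $\|x_{t_{k+1}}-\bar x_{t_{k+1}}\|_{x_{t_k}}\le\delta$, where $\bar x_{t_{k+1}}$ is the exact solution of this subproblem.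
   Formalization: As printed, the claim fails: in m̂₀ the factor n_ν is moved to the numerator, the choice of t₀ must also give m̂₀ < (1−β)/(3+β), and a δ-solution must also have subproblem value within δ²/2 of the minimum. *)

(* Defs.v *)
From HB Require Import structures.
From mathcomp Require Export all_boot all_order all_algebra.
From mathcomp Require Export all_classical all_reals all_analysis.
Export Order.TTheory GRing.Theory Num.Theory.
Export numFieldNormedType.Exports.

Set Implicit Arguments.
Unset Strict Implicit.
Unset Printing Implicit Defensive.

Global Open Scope classical_set_scope.
Global Open Scope ring_scope.

Section Calculus.
Context {R : realType} {p : nat}.
Implicit Types (f : 'rV[R]_p -> R) (x u v : 'rV[R]_p) (D : set 'rV[R]_p).

Definition dot u v : R := \sum_(i < p) u 0 i * v 0 i.

(* In finite dimension this inductive definition is the usual class C^k on an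
   open set D. *)
Fixpoint continuously_differentiable (k : nat) D f : Prop :=
  match k with
  | 0 => forall x, D x -> {for x, continuous f}
  | k'.+1 => (forall x, D x -> differentiable f x) /\
             forall v, continuously_differentiable k' D ('D_v f)
  end.

Definition grad f x : 'rV[R]_p := \row_i 'D_(delta_mx 0 i) f x.

Definition hess f x : 'M[R]_p :=
  \matrix_(i, j) 'D_(delta_mx 0 i) ('D_(delta_mx 0 j) f) x.

Definition positive_definite (A : 'M[R]_p) : Prop :=
  forall u, u != 0 -> 0 < dot (u *m A) u.

(* Meant for points where the Hessian is positive definite (invmx is the
   identity on singular matrices). *)
Definition lnorm f x u : R := Num.sqrt (dot (u *m hess f x) u).
Definition dual_lnorm f x v : R := Num.sqrt (dot (v *m invmx (hess f x)) v).

End Calculus.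

Section ConvexAnalysis.
Context {R : realType} {p : nat}.
Implicit Types (g : 'rV[R]_p -> \bar R) (x : 'rV[R]_p).

Definition edom g : set 'rV[R]_p := [set x | (g x < +oo)%E].

Definition epigraph g : set ('rV[R]_p * R^o) :=
  [set z | (g z.1 <= (z.2)%:E)%E].

Definition proper g : Prop := (forall x, g x != -oo%E) /\ edom g !=set0.

Definition closed_convex g : Prop :=
  closed (epigraph g) /\ convex_set (epigraph g).

Definition subdifferential g x : set 'rV[R]_p :=
  [set xi | edom g x /\ forall y, (g x + (dot xi (y - x))%:E <= g y)%E].

Definition minimizer_on (A : set 'rV[R]_p) (F : 'rV[R]_p -> \bar R) x : Prop :=
  A x /\ forall y, A y -> (F x <= F y)%E.

End ConvexAnalysis.

Section Barrier.
Context {R : realType} {p : nat}.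
Implicit Types (D X : set 'rV[R]_p) (f : 'rV[R]_p -> R).

(* f is a nu-self-concordant barrier of X with (open) domain D; the values of
   f outside D are irrelevant. *)
Record self_concordant_barrier (nu : R) X D f : Prop := {
  scb_open : open D ;
  scb_closure : closure D = X ;
  scb_convex_dom : convex_set D ;
  scb_convex : convex_function D f ;
  scb_smooth : continuously_differentiable 3 D f ;
  scb_third : forall x v (tau : R), D x -> D (x + tau *: v) ->
    let phi := fun s : R => f (x + s *: v) in
    `| (phi^`(3))%classic tau | <= 2 * ((phi^`(2))%classic tau) `^ (3 / 2) ;
  scb_parameter : forall x u, D x ->
    2 * dot (grad f x) u - lnorm f x u ^+ 2 <= nu ;
  scb_boundary : forall y, closure D y -> ~ D y ->
    f z @[z --> within D (nbhs y)] --> +oo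
}.

Definition log_homogeneous (nu : R) D f : Prop :=
  forall x (tau : R), D x -> 0 < tau ->
    D (tau *: x) /\ f (tau *: x) = f x - nu * ln tau.

Definition n_nu (nu : R) D f : R :=
  if `[< log_homogeneous nu D f >] then 1 else nu + 2 * Num.sqrt nu.

End Barrier.

Section Constants.
Context {R : realType}.
Implicit Types beta nn kappa m nu : R.

Definition a_0 beta nn : R := (1 - beta) / ((3 + beta) * nn).

Definition delta beta : R := beta / 16.

Definition kappa_max beta nn : R :=
  (2 * a_0 beta nn + 1 - Num.sqrt (4 * a_0 beta nn ^+ 2 + 1)) / 2.

(* nn is a factor here: at the analytical center zeta_0 has dual local norm at
   most (1 - kappa) (kappa + c0 / t0) / (1 - 2 kappa), and passing from the
   center to an arbitrary interior point costs a factor n_nu. *)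
Definition m_hat nn kappa (t0 c0 : R) : R :=
  nn * ((1 - kappa) * (kappa + t0^-1 * c0)) / (1 - 2 * kappa).

Definition r_beta beta : R := 43 / 100 * Num.sqrt beta.

Definition gamma_1 beta m : R :=
  (1 - m) * beta / (1 - 2 * m) + m / (1 - m).

Definition gamma_hat beta m : R :=
  r_beta beta * (1 - m) / (1 - 2 * m) + m / (1 - m).

Definition psi_beta beta m nu : R :=
  let g1 := gamma_1 beta m in
  let gh := gamma_hat beta m in
  nu + Num.sqrt nu * (g1 / (1 - gh))
  + gh / (1 - gh) ^+ 2 * (gh + g1 + delta beta)
  + delta beta ^+ 2 / 2 + m * g1.

Definition c_beta beta : R :=
  (1 + r_beta beta - Num.sqrt ((1 - r_beta beta) ^+ 2 + 4 * beta)) / 2.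

Definition sigma_beta beta nu : R :=
  c_beta beta / ((1 + c_beta beta) * Num.sqrt nu).

End Constants.

Section Algorithm.
Context {R : realType} {p : nat}.
Variables (f : 'rV[R]_p -> R) (c : 'rV[R]_p) (g : 'rV[R]_p -> \bar R).
Variable X : set 'rV[R]_p.

Definition objective (x : 'rV[R]_p) : \bar R := ((dot c x)%:E + g x)%E.

Definition optimal_value : \bar R := ereal_inf (objective @` X).

Definition eps_solution (eps : R) (x : 'rV[R]_p) : Prop :=
  X x /\ (objective x - optimal_value <= eps%:E)%E.

Definition subproblem (eta : R) (zeta0 : 'rV[R]_p) (t : R) (x y : 'rV[R]_p) :
    \bar R :=
  ((dot (grad f x - eta *: zeta0) (y - x)
    + 2^-1 * dot ((y - x) *m hess f x) (y - x))%:E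
   + (t^-1)%:E * objective y)%E.

(* The bound on the subproblem value implies the one on the distance, but not
   conversely: g is extended-valued, so closeness to xbar alone would allow
   z to be infeasible for g. *)
Definition delta_solution (dlt eta : R) (zeta0 : 'rV[R]_p) (t : R)
    (x z : 'rV[R]_p) : Prop :=
  interior X z /\
  exists xbar, [/\ minimizer_on setT (subproblem eta zeta0 t x) xbar,
    lnorm f x (z - xbar) <= dlt
  & (subproblem eta zeta0 t x z
       <= subproblem eta zeta0 t x xbar + (dlt ^+ 2 / 2)%:E)%E].

(* (tt k, xx k) is the k-th pair (t_k, x_{t_k}); nothing is required of the
   sequences past the first k at which the stopping test holds. *)
Definition path_following_run (eps beta psi sigma eta : R)
    (zeta0 x0 : 'rV[R]_p) (t0 : R) (tt : nat -> R) (xx : nat -> 'rV[R]_p) :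
    Prop :=
  [/\ tt 0%N = t0, xx 0%N = x0
    & forall k, eps < tt k * psi ->
        tt k.+1 = (1 - sigma) * tt k /\
        delta_solution (delta beta) eta zeta0 (tt k.+1) (xx k) (xx k.+1)].

End Algorithm.

(* Main.v *)
(* The proof follows the inexact iterates without ever constructing the central
   path. Let x be the current iterate, z the exact solution of the subproblem that
   produced it, and xi the subgradient of G at z given by the optimality condition of
   that subproblem. The invariant is that z is close to x in the local norm at x and
   that xi / t + grad f x - zeta0 + hess f x (z - x) is small in the dual local norm.
   Monotonicity of the subdifferential of G between two consecutive exact solutions
   bounds their distance by roughly sigma (sqrt nu + |zeta0|) / (1 - sigma), and the
   quadratic error of the Newton model restores the invariant.

   The dual local norm of zeta0 is below roughly m at every point of D, because D
   is contained in a ball of radius about n_nu around x0 while Dikin ellipsoids are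
   contained in D. At an iterate the optimality gap is at most
   t (delta^2 / 2 + <grad f x + w, y - x>), where the dual local norm of w is some
   F < 1. For y in D this inner product is at most nu + sqrt nu F / (1 - F): when y
   is far from x, self-concordance makes <grad f x, y - x> decrease linearly in the
   distance, which absorbs the perturbation w. Together with delta^2 / 2 that value
   is below psi_beta. Since t decreases by the factor 1 - sigma with
   1 / sigma = O(sqrt nu), and psi_beta <= 100 nu, the number of iterations is
   O(sqrt nu log (nu / eps)). *)
Require Import Defs.
From mathcomp Require Import ring lra.

Set Implicit Arguments.
Unset Strict Implicit.
Unset Printing Implicit Defensive.

(** * Calculus on an interval *)

Section RealLine.
Context {R : realType}.
Implicit Types (F G dF h dh : R -> R) (a b s r nu eps : R).

Lemma is_derive_mvt F dF a b : a <= b ->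
  (forall s, a <= s <= b -> is_derive s 1 F (dF s)) ->
  exists2 s, a <= s <= b & F b - F a = dF s * (b - a).
Proof.
move=> ab dFP.
have [||s] := @MVT_segment R F dF a b ab; last by rewrite in_itv; exists s.
- by move=> s; rewrite in_itv/= => /andP[/ltW as_ /ltW sb]; apply: dFP; rewrite as_.
- apply: derivable_within_continuous => s; rewrite in_itv/= => asb.
  by have [] := dFP _ asb.
Qed.

(** The mean point lies strictly inside, which the strict inequalities in [hess_ge0] require. *)
Lemma is_derive_mvt_oo F dF a b : a < b ->
  (forall s, a <= s <= b -> is_derive s 1 F (dF s)) ->
  exists2 s, a < s < b & F b - F a = dF s * (b - a).
Proof.
move=> ab dFP.
have [||s] := @MVT R F dF a b ab; last by rewrite in_itv; exists s.
- by move=> s; rewrite in_itv/= => /andP[/ltW as_ /ltW sb]; apply: dFP; rewrite as_.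
- apply: derivable_within_continuous => s; rewrite in_itv/= => asb.
  by have [] := dFP _ asb.
Qed.

Lemma is_derive_ge0_le F dF a b : a <= b ->
  (forall s, a <= s <= b -> is_derive s 1 F (dF s)) ->
  (forall s, a <= s <= b -> 0 <= dF s) -> F a <= F b.
Proof.
move=> ab dFP dF0; have [s sab e] := is_derive_mvt ab dFP.
by rewrite -subr_ge0 e mulr_ge0 ?subr_ge0 ?dF0.
Qed.

Lemma is_derive_le F dF G dG a b : a <= b ->
  (forall s, a <= s <= b -> is_derive s 1 F (dF s)) ->
  (forall s, a <= s <= b -> is_derive s 1 G (dG s)) ->
  (forall s, a <= s <= b -> dF s <= dG s) -> F b - F a <= G b - G a.
Proof.
move=> ab dFP dGP dFG.
suff : (G - F) a <= (G - F) b by rewrite !fctE; lra.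
apply: (is_derive_ge0_le (dF := dG - dF)) => // s sab.
  by rewrite fctE; have := dFP _ sab; have := dGP _ sab => ? ?; apply: is_deriveB.
by rewrite !fctE subr_ge0 dFG.
Qed.

Lemma is_derive_mull (K s : R) : is_derive s 1 (fun r : R => K * r) K.
Proof. by apply: is_derive_eq; rewrite /GRing.scale /=; ring. Qed.

Lemma is_derive_shiftV a b s : a + b * s != 0 ->
  is_derive s 1 (fun s => (a + b * s)^-1) (- b / (a + b * s) ^+ 2).
Proof.
move=> h.
have d : is_derive s 1 (fun s => a + b * s) b.
  by apply: is_derive_eq; rewrite /GRing.scale /=; ring.
have e := is_deriveV (f := fun s => a + b * s) h d.
by apply: is_derive_eq; rewrite /GRing.scale /= mulrC mulrN mulNr.
Qed.

(* Adding eps > 0 to h preserves the differential inequality and makes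
   (h + eps)^(-1/2) a 1-Lipschitz function. *)
Lemma sqrt_self_concordant_lt h dh a b eps : 0 < eps -> a <= b ->
  (forall s, a <= s <= b -> is_derive s 1 h (dh s)) ->
  (forall s, a <= s <= b -> 0 <= h s) ->
  (forall s, a <= s <= b -> `|dh s| <= 2 * h s * Num.sqrt (h s)) ->
  `|Num.sqrt (h a + eps) - Num.sqrt (h b + eps)|
    <= (b - a) * (Num.sqrt (h a + eps) * Num.sqrt (h b + eps)).
Proof.
move=> eps0 ab dhP h0 hdh.
pose k s := Num.sqrt (h s + eps).
have k0 s : a <= s <= b -> 0 < k s.
  by move=> /h0 hs; rewrite sqrtr_gt0; lra.
have dkP s : a <= s <= b ->
    is_derive s 1 (fun s => (k s)^-1) (- (k s) ^- 2 * ((2 * k s)^-1 * dh s)).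
  move=> sab; have hs := h0 _ sab; have he : 0 < h s + eps by lra.
  have d1 : is_derive s 1 (fun s => h s + eps) (dh s).
    by have ? := dhP _ sab; apply: is_derive_eq; rewrite addr0.
  have d2 : is_derive s 1 k ((2 * k s)^-1 * dh s).
    have ? := is_derive1_sqrt he.
    exact: (is_derive1_comp (f := Num.sqrt) (g := fun s => h s + eps)).
  by apply: is_deriveV; rewrite gt_eqF ?k0.
(* The derivative of [1 / k] is [- dh / (2 k^3)], and [|dh| <= 2 h sqrt h <= 2 k^3]. *)
have dk1 s : a <= s <= b -> `|- (k s) ^- 2 * ((2 * k s)^-1 * dh s)| <= 1.
  move=> sab; have ks := k0 _ sab; have hs := h0 _ sab.
  rewrite mulrA normrM mulNr normrN [X in X * _]ger0_norm; last first.
    by rewrite mulr_ge0 ?invr_ge0 ?exprn_ge0 ?mulr_ge0 ?ltW.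
  rewrite -invfM mulrC ler_pdivrMr ?mulr_gt0 ?exprn_gt0 //.
  rewrite mul1r (le_trans (hdh _ sab)) //.
  have e1 : k s ^+ 2 = h s + eps by rewrite sqr_sqrtr //; lra.
  have e2 : Num.sqrt (h s) <= k s by rewrite ler_wsqrtr //; lra.
  rewrite [leRHS](_ : _ = 2 * (h s + eps) * k s); last by rewrite -e1; ring.
  by rewrite ler_pM ?sqrtr_ge0 ?mulr_ge0 // ler_pM2l //; lra.
have [s sab e] := is_derive_mvt ab dkP.
have aab : a <= a <= b by rewrite lexx.
have bab : a <= b <= b by rewrite lexx ab.
have ka := k0 _ aab; have kb := k0 _ bab.
rewrite -/(k a) -/(k b).
have -> : k a - k b = (k a * k b) * ((k b)^-1 - (k a)^-1).
  by field; rewrite !gt_eqF.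
have kk : 0 < k a * k b by rewrite mulr_gt0.
rewrite e normrM (gtr0_norm kk) [leRHS]mulrC ler_pM2l // normrM [X in _ * X]ger0_norm ?subr_ge0 //.
by rewrite ler_piMl ?subr_ge0 // dk1.
Qed.

Lemma sqrtr_add_le a eps : 0 <= a -> 0 <= eps ->
  Num.sqrt (a + eps ^+ 2) <= Num.sqrt a + eps.
Proof.
move=> a0 e0; rewrite -[leRHS]ger0_norm ?addr_ge0 ?sqrtr_ge0 // -sqrtr_sqr.
rewrite ler_wsqrtr // sqrrD sqr_sqrtr // lerD2r lerDl mulrn_wge0 //.
by rewrite mulr_ge0 ?sqrtr_ge0.
Qed.

(* The division-free form of "h^(-1/2) is 1-Lipschitz". *)
Lemma sqrt_self_concordant h dh a b : a <= b ->
  (forall s, a <= s <= b -> is_derive s 1 h (dh s)) ->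
  (forall s, a <= s <= b -> 0 <= h s) ->
  (forall s, a <= s <= b -> `|dh s| <= 2 * h s * Num.sqrt (h s)) ->
  `|Num.sqrt (h a) - Num.sqrt (h b)|
    <= (b - a) * (Num.sqrt (h a) * Num.sqrt (h b)).
Proof.
move=> ab dhP h0 hdh.
have ha : 0 <= h a by rewrite h0 // lexx.
have hb : 0 <= h b by rewrite h0 // lexx ab.
set A := Num.sqrt (h a); set B := Num.sqrt (h b).
have A0 : 0 <= A by rewrite sqrtr_ge0.
have B0 : 0 <= B by rewrite sqrtr_ge0.
apply/ler_addgt0Pr => e e0.
(* Replacing [A'], [B'] by [A], [B] costs at most [d * M] in total, so [d <= e / M] suffices. *)
pose M := 1 + (b - a) * (A + B + 1).
have M0 : 0 < M by rewrite ltr_pwDl // mulr_ge0 ?subr_ge0 // addr_ge0 // addr_ge0.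
pose d := Num.min 1 (e / M).
have d0 : 0 < d by rewrite lt_min ltr01 divr_gt0.
have d1 : d <= 1 by rewrite ge_min lexx.
have dM : d * M <= e by rewrite -ler_pdivlMr // ge_min lexx orbT.
have := sqrt_self_concordant_lt (exprn_gt0 2 d0) ab dhP h0 hdh.
set A' := Num.sqrt (h a + _); set B' := Num.sqrt (h b + _).
have A1 : A' <= A + d by apply: sqrtr_add_le => //; exact: ltW.
have B1 : B' <= B + d by apply: sqrtr_add_le => //; exact: ltW.
have A2 : A <= A' by rewrite ler_wsqrtr // lerDl exprn_ge0 ?ltW.
have B2 : B <= B' by rewrite ler_wsqrtr // lerDl exprn_ge0 ?ltW.
have AB : A' * B' <= A * B + d * (A + B + 1).
  apply: (@le_trans _ _ ((A + d) * (B + d))); first by rewrite ler_pM ?sqrtr_ge0.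
  have : d * d <= d * 1 by rewrite ler_pM2l.
  lra.
have := ler_wpM2l (_ : 0 <= b - a) AB; rewrite subr_ge0 => /(_ ab).
have : d * M = d + (b - a) * (d * (A + B + 1)) by rewrite /M; ring.
rewrite !ler_norml => e1 e2 /andP[e3 e4]; clearbody A B A' B' d M.
clear - e1 e2 e3 e4 dM A1 B1 A2 B2.
by apply/andP; split; lra.
Qed.

End RealLine.

Section LocalBehaviour.
Context {R : realType}.

Lemma is_derive_neg_lt (g : R -> R) (d : R) : is_derive (0 : R) 1 g d -> d < 0 ->
  exists2 e, 0 < e & forall s, 0 < s < e -> g s < g 0 /\ g 0 < g (- s).
Proof.
move=> [dg eg] d0.
have cg : (fun h => h^-1 *: (g (h *: 1 + 0) - g 0)) @ 0^' --> d.
  by rewrite -eg; exact: dg.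
have : \forall h \near (0 : R)^', h^-1 *: (g (h *: 1 + 0) - g 0) < 0.
  exact: (cvgr_lt d cg).
rewrite near_withinE => /nbhs_ballP[e /= e0 he].
have q s : s != 0 -> `|s| < e -> s^-1 * (g s - g 0) < 0.
  move=> s0 se; have := he s; rewrite -ball_normE /= sub0r normrN => /(_ se s0).
  by rewrite /GRing.scale /= mulr1 addr0.
exists e => // s /andP[s0 se]; split.
- have := q s; rewrite gt_eqF // gtr0_norm // => /(_ isT se).
  by rewrite pmulr_rlt0 ?invr_gt0 // subr_lt0.
- have := q (- s); rewrite oppr_eq0 gt_eqF // normrN gtr0_norm // => /(_ isT se).
  by rewrite invrN mulNr oppr_lt0 pmulr_rgt0 ?invr_gt0 // subr_gt0.
Qed.

(** Divide by [t] and let [t] tend to 0. This extracts the first-order condition from minimality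
    along a segment. *)
Lemma first_order_ge0 (a b : R) :
  (forall t, 0 < t -> t <= 1 -> 0 <= t * a + t ^+ 2 * b) -> 0 <= a.
Proof.
move=> h; rewrite leNgt; apply/negP => a0.
have b0 : 0 < `|b| + 1 by rewrite ltr_pwDr.
pose t := Num.min 1 (- a / 2 / (`|b| + 1)).
have t0 : 0 < t by rewrite lt_min ltr01 divr_gt0 // divr_gt0 // oppr_gt0.
have t1 : t <= 1 by rewrite ge_min lexx.
have tb : t * (`|b| + 1) <= - a / 2 by rewrite -ler_pdivlMr // ge_min lexx orbT.
have := h t t0 t1; rewrite expr2 -mulrA -mulrDr pmulr_rge0 //.
have : t * b <= t * `|b| by rewrite ler_pM2l // ler_norm.
move: tb; rewrite mulrDr mulr1; move: (t * `|b|) (t * b) => u v; lra.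
Qed.

Lemma powR32 (a : R) : 0 <= a -> a `^ (3 / 2) = a * Num.sqrt a.
Proof.
move=> a0; have [->|an0] := eqVneq a 0; first by rewrite powR0 ?mul0r // mulf_neq0 // invr_eq0.
rewrite (_ : 3 / 2 = 1 + 2^-1); last by lra.
by rewrite powRD ?an0 ?implybT // powRr1 // powR12_sqrt.
Qed.

End LocalBehaviour.

(** * Directional derivatives *)

Section Directional.
Context {R : realType} {p : nat}.
Implicit Types (f : 'rV[R]_p -> R) (x u v w : 'rV[R]_p) (D : set 'rV[R]_p).

Lemma dotDl u v w : dot (u + v) w = dot u w + dot v w.
Proof. by rewrite /dot -big_split; apply: eq_bigr => i _; rewrite mxE mulrDl. Qed.

Lemma dotZl (a : R) u v : dot (a *: u) v = a * dot u v.
Proof. by rewrite /dot mulr_sumr; apply: eq_bigr => i _; rewrite mxE mulrA. Qed.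

Lemma dotC u v : dot u v = dot v u.
Proof. by apply: eq_bigr => i _; rewrite mulrC. Qed.

Lemma dotDr u v w : dot u (v + w) = dot u v + dot u w.
Proof. by rewrite dotC dotDl !(dotC u). Qed.

Lemma dotZr (a : R) u v : dot u (a *: v) = a * dot u v.
Proof. by rewrite dotC dotZl (dotC u). Qed.

Lemma dotNl u v : dot (- u) v = - dot u v.
Proof. by rewrite -scaleN1r dotZl mulN1r. Qed.

Lemma dotNr u v : dot u (- v) = - dot u v.
Proof. by rewrite dotC dotNl dotC. Qed.

Lemma dotBl u v w : dot (u - v) w = dot u w - dot v w.
Proof. by rewrite dotDl dotNl. Qed.

Lemma dotBr u v w : dot u (v - w) = dot u v - dot u w.
Proof. by rewrite dotDr dotNr. Qed.

Lemma dot0r u : dot u 0 = 0.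
Proof. by rewrite -(scale0r 0) dotZr mul0r. Qed.

Lemma is_derive_line f x u s : derivable f (x + s *: u) u ->
  is_derive s 1 (fun s : R => f (x + s *: u)) ('D_u f (x + s *: u)).
Proof.
move=> df.
have e : (fun h : R => h^-1 *: (((fun s : R => f (x + s *: u)) \o shift s) (h *: (1:R))
            - f (x + s *: u)))
       = (fun h => h^-1 *: ((f \o shift (x + s *: u)) (h *: u) - f (x + s *: u))).
  apply/funext => h /=; congr (_ *: (f _ - _)).
  by rewrite [h *: 1]mulr1 scalerDl addrCA.
by apply: DeriveDef; rewrite /derivable /derive e.
Qed.

Lemma derive_linear f x (a : R) u v : differentiable f x ->
  'D_(a *: u + v) f x = a * 'D_u f x + 'D_v f x.
Proof. by move=> df; rewrite !deriveE // linearP. Qed.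

Lemma derive_dir_sum f x (I : Type) (r : seq I) (P : pred I) (F : I -> 'rV[R]_p) :
  differentiable f x ->
  'D_(\sum_(i <- r | P i) F i) f x = \sum_(i <- r | P i) 'D_(F i) f x.
Proof.
move=> df; rewrite deriveE // linear_sum; apply: eq_bigr => i _.
by rewrite deriveE.
Qed.

Lemma derive_dirZ f x (a : R) u : differentiable f x ->
  'D_(a *: u) f x = a * 'D_u f x.
Proof. by move=> df; rewrite !deriveE // linearZ. Qed.

Lemma dot_grad f x v : differentiable f x -> dot (grad f x) v = 'D_v f x.
Proof.
move=> df; rewrite [v in RHS]row_sum_delta derive_dir_sum //.
by apply: eq_bigr => i _; rewrite derive_dirZ // !mxE mulrC.
Qed.

Lemma dot_hess D f x u v : open D -> continuously_differentiable 2 D f -> D x ->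
  dot (u *m hess f x) v = 'D_u ('D_v f) x.
Proof.
move=> oD [fD d2f] Dx.
have df2 w y : D y -> differentiable ('D_w f) y by move=> Dy; have [+ _] := d2f w; apply.
have -> : 'D_u ('D_v f) x = 'D_u (\sum_(j < p) (fun y => v 0 j * 'D_(delta_mx 0 j) f y)) x.
  apply: near_eq_derive; have : \near x, D x by exact: open_nbhs_nbhs.
  apply: filterS => y /= Dy.
  rewrite [v in LHS]row_sum_delta derive_dir_sum ?fct_sumE; last exact: fD.
  by apply: eq_bigr => j _; rewrite derive_dirZ //; exact: fD.
rewrite derive_sum; last first.
  by move=> j; apply: derivableM => //; apply: diff_derivable; exact: df2.
apply: eq_bigr => j _; rewrite mulrC mxE.
rewrite (_ : (fun y => _) = v 0 j \*: 'D_(delta_mx 0 j) f) //.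
rewrite deriveZ; last by apply: diff_derivable; exact: df2.
congr (_ * _); rewrite [u in RHS]row_sum_delta derive_dir_sum; last exact: df2.
by apply: eq_bigr => i _; rewrite derive_dirZ ?mxE //; exact: df2.
Qed.

(** The mean value theorem is applied twice: in direction [u] to the difference of [f] on two
    parallel sides of the parallelogram, then in direction [v] to ['D_u f]. *)
Lemma mixed_difference f x u v (h : R) : 0 <= h ->
  (forall s t : R, 0 <= s <= h -> 0 <= t <= h ->
     [/\ differentiable f (x + s *: u + t *: v) &
         differentiable ('D_u f) (x + s *: u + t *: v)]) ->
  exists s t : R, [/\ 0 <= s <= h, 0 <= t <= h &
    f (x + h *: u + h *: v) - f (x + h *: u) - f (x + h *: v) + f x
      = h ^+ 2 * 'D_v ('D_u f) (x + s *: u + t *: v)].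
Proof.
move=> h0 df.
have hh : 0 <= h <= h by rewrite h0 lexx.
have h00 : 0 <= (0 : R) <= h by rewrite lexx h0.
pose G (t : R) := fun s : R => f (x + t *: v + s *: u).
have dG t s : 0 <= t <= h -> 0 <= s <= h ->
    is_derive s 1 (G t) ('D_u f (x + t *: v + s *: u)).
  move=> t01 s01; apply: is_derive_line; apply: diff_derivable.
  by rewrite addrAC; have [] := df s t s01 t01.
have [s s01 es] : exists2 s, 0 <= s <= h &
    (G h - G 0) h - (G h - G 0) 0
      = ('D_u f (x + h *: v + s *: u) - 'D_u f (x + 0 *: v + s *: u)) * (h - 0).
  apply: is_derive_mvt => // s s01.
  by have := dG h s hh s01; have := dG 0 s h00 s01 => ? ?; apply: is_deriveB.
have [||t t01 et] := @is_derive_mvt _ (fun t => 'D_u f (x + s *: u + t *: v))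
    (fun t => 'D_v ('D_u f) (x + s *: u + t *: v)) 0 h.
- exact: h0.
- move=> t t01; apply: is_derive_line; apply: diff_derivable.
  by have [] := df s t s01 t01.
exists s, t; split => //.
move: es; rewrite (addrAC x (h *: v)) (addrAC x (0 *: v)) et /G !fctE !subr0 => es.
move: es; rewrite !scale0r !addr0 (addrAC x (h *: v)) => es.
move: es; rewrite opprB addrA addrAC => ->.
by rewrite [LHS]mulrC [X in h * X]mulrC mulrA -expr2.
Qed.

(** Schwarz's theorem: one second difference over a small parallelogram equals [h^2] times a value
    of either mixed derivative at some point near [x], and both derivatives are continuous at
    [x]. *)
Lemma derive_sym f x u v D : open D -> D x ->
  continuously_differentiable 2 D f ->
  'D_u ('D_v f) x = 'D_v ('D_u f) x.
Proof.
move=> oD Dx [fD d2f].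
have df2 w y : D y -> differentiable ('D_w f) y by move=> Dy; have [+ _] := d2f w; apply.
have c2 w z : {for x, continuous ('D_z ('D_w f))}.
  by have [_ +] := d2f w; move/(_ z); apply.
apply/eqP; rewrite -subr_eq0 -normr_le0; apply/ler_addgt0Pr => e e0; rewrite add0r.
have e2 : 0 < e / 2 by rewrite divr_gt0.
have N1 : \forall y \near x, D y by exact: open_nbhs_nbhs.
have cont (g : 'rV[R]_p -> R) : {for x, continuous g} ->
    \forall y \near x, `|g x - g y| < e / 2.
  by move=> cg; move/cvgrPdist_lt: cg; apply.
have N2 := cont ('D_u ('D_v f)) (c2 v u); have N3 := cont ('D_v ('D_u f)) (c2 u v).
have N := @filterI _ _ (nbhs_filter x) _ _ N1 (@filterI _ _ (nbhs_filter x) _ _ N2 N3).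
have [d /= d0 dN] := (nbhs_ballP _ _).1 N.
(* The parallelogram spanned by [h *: u] and [h *: v] then lies in the ball of radius [d]; the [+ 1]
   covers [u = v = 0]. *)
pose h := d / (2 * (`|u| + `|v| + 1)).
have k0 : 0 < `|u| + `|v| + 1 by rewrite ltr_pwDr // addr_ge0.
have h0 : 0 < h by rewrite divr_gt0 // mulr_gt0.
have B s t : 0 <= s <= h -> 0 <= t <= h -> ball x d (x + s *: u + t *: v).
  move=> /andP[s0 sh] /andP[t0 th]; rewrite -ball_normE /= -addrA opprD addNKr normrN.
  apply: (le_lt_trans (ler_normD _ _)); rewrite !normrZ !ger0_norm //.
  apply: (@le_lt_trans _ _ (h * (`|u| + `|v|))).
    by rewrite mulrDr lerD // ler_wpM2r.
  apply: (@lt_le_trans _ _ (h * (2 * (`|u| + `|v| + 1)))).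
    by rewrite ltr_pM2l //; have := normr_ge0 u; have := normr_ge0 v; lra.
  by rewrite divfK // gt_eqF // mulr_gt0.
have [|s1 [t1 [s1h t1h E1]]] := @mixed_difference f x u v h (ltW h0).
- by move=> s t s01 t01; have [Dy _] := dN _ (B _ _ s01 t01); split; [apply: fD|apply: df2].
have [|s2 [t2 [s2h t2h E2]]] := @mixed_difference f x v u h (ltW h0).
- move=> s t s01 t01; rewrite addrAC.
  by have [Dy _] := dN _ (B _ _ t01 s01); split; [apply: fD|apply: df2].
have [_ [_ I1]] := dN _ (B _ _ s1h t1h).
have [_ [I2 _]] := dN _ (B _ _ t2h s2h).
move: E2; rewrite (addrAC _ (h *: v)) (addrAC _ (s2 *: v)) => E2.
have swap (a b c a' e1 e3 : R) : a - b - c + a' = e1 -> a - c - b + a' = e3 -> e1 = e3.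
  by move=> <- <-; ring.
have close (a a' b c : R) : a' = a -> `|b - a'| < e / 2 -> `|c - a| < e / 2 -> `|c - b| <= e.
  clear; move=> ->; rewrite !ltr_norml ler_norml => /andP[? ?] /andP[? ?].
  by apply/andP; split; lra.
have E := mulfI (lt0r_neq0 (exprn_gt0 2 h0)) (swap _ _ _ _ _ _ E1 E2).
exact: (close _ _ _ _ E I1 I2).
Qed.

End Directional.

(** * Derivatives of a smooth function along lines *)

Section Smooth.
Context {R : realType} {p : nat}.
Context (f : 'rV[R]_p -> R) (D : set 'rV[R]_p).
Context (oD : open D) (sD : continuously_differentiable 3 D f).
Implicit Types (x u v w : 'rV[R]_p) (s : R).

Definition third x u v w : R := 'D_u ('D_v ('D_w f)) x.

Let d1 x : D x -> differentiable f x.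
Proof. by case: sD => + _; apply. Qed.

Let d2 x v : D x -> differentiable ('D_v f) x.
Proof. by case: sD => _ /(_ v) [+ _]; apply. Qed.

Let d3 x v w : D x -> differentiable ('D_v ('D_w f)) x.
Proof. by case: sD => _ /(_ w) [_ /(_ v)] [+ _]; apply. Qed.

Let c2 : continuously_differentiable 2 D f.
Proof.
split; first exact: d1.
move=> v; split; first by move=> x; exact: d2.
by move=> w x Dx; apply: differentiable_continuous; exact: d3.
Qed.

Let c2D v : continuously_differentiable 2 D ('D_v f).
Proof. exact: (sD.2 v). Qed.

Lemma near_open_line x u s : D (x + s *: u) -> \forall r \near s, D (x + r *: u).
Proof.
move=> Dx; have cl : {for s, continuous (fun r : R => x + r *: u)}.
  by apply: continuousD; [exact: cst_continuous|exact: scalel_continuous].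
exact: (cl _ (open_nbhs_nbhs (conj oD Dx))).
Qed.

(** In the applications [g] is a [dot] expression that is known to equal the directional derivative
    [k] only on [D]; openness of [D] gives the equality near [s]. *)
Lemma is_derive_line_eq (g k : 'rV[R]_p -> R) x u s : D (x + s *: u) ->
  (forall y, D y -> g y = k y) -> differentiable k (x + s *: u) ->
  is_derive s 1 (fun r : R => g (x + r *: u)) ('D_u k (x + s *: u)).
Proof.
move=> Dx gk dk.
have := is_derive_line (diff_derivable (v := u) dk).
apply: near_eq_is_derive.
by apply: filterS (near_open_line Dx) => r Dr; rewrite gk.
Qed.

Lemma dot_gradE v x : D x -> dot (grad f x) v = 'D_v f x.
Proof. by move=> /d1; exact: dot_grad. Qed.

Lemma dot_hessE u v x : D x -> dot (u *m hess f x) v = 'D_u ('D_v f) x.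
Proof. exact: dot_hess. Qed.

Lemma dot_hess_sym x u v : D x -> dot (u *m hess f x) v = dot (v *m hess f x) u.
Proof. move=> Dx; rewrite !(dot_hessE _ _ Dx); exact: (derive_sym u v oD Dx c2). Qed.

Lemma is_derive_f_line x u s : D (x + s *: u) ->
  is_derive s 1 (fun r : R => f (x + r *: u)) (dot (grad f (x + s *: u)) u).
Proof.
move=> Dx; rewrite (dot_gradE _ Dx); exact: (is_derive_line_eq Dx (fun _ _ => erefl) (d1 Dx)).
Qed.

Lemma is_derive_grad_line x u v s : D (x + s *: u) ->
  is_derive s 1 (fun r : R => dot (grad f (x + r *: u)) v)
    (dot (u *m hess f (x + s *: u)) v).
Proof.
move=> Dx; rewrite (dot_hessE _ _ Dx).
exact: (is_derive_line_eq (g := fun y => dot (grad f y) v) Dx (dot_gradE v) (d2 v Dx)).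
Qed.

Lemma is_derive_hess_line x u v w s : D (x + s *: u) ->
  is_derive s 1 (fun r : R => dot (v *m hess f (x + r *: u)) w)
    (third (x + s *: u) u v w).
Proof.
move=> Dx.
exact: (is_derive_line_eq (g := fun y => dot (v *m hess f y) w) Dx (dot_hessE v w) (d3 v w Dx)).
Qed.

Lemma third_sym12 x u v w : D x -> third x u v w = third x v u w.
Proof. move=> Dx; exact: (derive_sym u v oD Dx (c2D w)). Qed.

Lemma third_sym23 x u v w : D x -> third x u v w = third x u w v.
Proof.
move=> Dx; apply: near_eq_derive.
have : \forall y \near x, D y by exact: open_nbhs_nbhs.
apply: filterS => y Dy; exact: (derive_sym v w oD Dy c2).
Qed.

Lemma third_linear x (a : R) u u' v w : D x ->
  third x (a *: u + u') v w = a * third x u v w + third x u' v w.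
Proof. move=> Dx; exact: (derive_linear _ _ _ (d3 v w Dx)). Qed.

Lemma thirdZ x (a : R) u v w : D x -> third x (a *: u) v w = a * third x u v w.
Proof. move=> Dx; exact: (derive_dirZ _ _ (d3 v w Dx)). Qed.

Lemma derive1_line (g : 'rV[R]_p -> R) x u s : differentiable g (x + s *: u) ->
  (fun r : R => g (x + r *: u))^`()%classic s = 'D_u g (x + s *: u).
Proof.
move=> dg; rewrite derive1E.
by have /@derive_val := is_derive_line (diff_derivable (v := u) dg).
Qed.

Lemma derive1_near_eq (g k : R -> R) s : (\forall r \near s, g r = k r) ->
  g^`()%classic s = k^`()%classic s.
Proof. by move=> gk; rewrite !derive1E; exact: near_eq_derive. Qed.

(** Together with [derive3_line], this translates the one-variable derivatives in [scb_third] into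
    the Hessian and the trilinear form [third]. *)
Lemma derive2_line x u s : D (x + s *: u) ->
  (fun r : R => f (x + r *: u))^`(2)%classic s = dot (u *m hess f (x + s *: u)) u.
Proof.
move=> Dx; rewrite (dot_hessE _ _ Dx) derive1nS.
rewrite (@derive1_near_eq _ (fun r => 'D_u f (x + r *: u))).
  exact: (derive1_line (d2 u Dx)).
apply: filterS (near_open_line Dx) => r Dr.
rewrite derive1n1; exact: (derive1_line (d1 Dr)).
Qed.

Lemma derive3_line x u s : D (x + s *: u) ->
  (fun r : R => f (x + r *: u))^`(3)%classic s = third (x + s *: u) u u u.
Proof.
move=> Dx; rewrite derive1nS.
rewrite (@derive1_near_eq _ (fun r => 'D_u ('D_u f) (x + r *: u))).
  exact: (derive1_line (d3 u u Dx)).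
apply: filterS (near_open_line Dx) => r Dr.
rewrite (derive2_line Dr); exact: (dot_hessE _ _ Dr).
Qed.

End Smooth.

(** * Local norms *)

Section SemiNorm.
Context {R : realType}.

(** For [c > 0] the quadratic is evaluated at its vertex [- b / c]. For [c = 0] and [b] nonzero the
    affine function would take the value -1. *)
Lemma discriminant_le (a b c : R) : 0 <= c ->
  (forall t, 0 <= a + t * (2 * b) + t ^+ 2 * c) -> b ^+ 2 <= a * c.
Proof.
move=> c0 q; have [c_0|cn0] := eqVneq c 0; last first.
  have cgt0 : 0 < c by rewrite lt_neqAle eq_sym cn0.
  have := q (- b / c); rewrite -(pmulr_lge0 _ cgt0).
  have -> : (a + - b / c * (2 * b) + (- b / c) ^+ 2 * c) * c = a * c - b ^+ 2 by field.
  by rewrite subr_ge0.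
rewrite c_0 mulr0; have [->|bn0] := eqVneq b 0; first by rewrite expr0n.
have := q (- (a + 1) / (2 * b)); rewrite c_0 mulr0 addr0 divfK ?mulf_neq0 //.
lra.
Qed.

Context {p : nat} (H : 'M[R]_p).
Context (Hsym : forall u v, dot (u *m H) v = dot (v *m H) u).
Context (Hge0 : forall u, 0 <= dot (u *m H) u).
Implicit Types u v : 'rV[R]_p.

Lemma form_cs u v :
  `|dot (u *m H) v| <= Num.sqrt (dot (u *m H) u) * Num.sqrt (dot (v *m H) v).
Proof.
rewrite -sqrtrM // -sqrtr_sqr ler_wsqrtr // discriminant_le // => t.
have -> : dot (u *m H) u + t * (2 * dot (u *m H) v) + t ^+ 2 * dot (v *m H) v
  = dot ((u + t *: v) *m H) (u + t *: v); last exact: Hge0.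
rewrite mulmxDl -scalemxAl !dotDl !dotDr !dotZl !dotZr (Hsym v u).
move: (dot _ _) (dot _ _) (dot _ _) => A B C; ring.
Qed.

Lemma form_triangle u v : Num.sqrt (dot ((u + v) *m H) (u + v))
  <= Num.sqrt (dot (u *m H) u) + Num.sqrt (dot (v *m H) v).
Proof.
rewrite -[leRHS]ger0_norm ?addr_ge0 ?sqrtr_ge0 // -sqrtr_sqr ler_wsqrtr //.
rewrite sqrrD !sqr_sqrtr // mulmxDl !dotDl !dotDr (Hsym v u).
have := le_trans (ler_norm _) (form_cs u v).
move: (dot _ _) (dot _ _) (Num.sqrt _ * _) (dot _ _) => A B C E; lra.
Qed.

End SemiNorm.

Section Convexity.
Context {R : realType} {p : nat}.
Implicit Types (x y u v : 'rV[R]_p) (D : set 'rV[R]_p).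

Lemma convex_set_segment D x y (t : R) : convex_set D -> D x -> D y ->
  0 <= t <= 1 -> D (x + t *: (y - x)).
Proof.
move=> cD Dx Dy /andP[t0 t1].
have := cD y x (Itv01 t0 t1); rewrite !inE => /(_ Dy Dx).
rewrite /conv /= /unstable.onem scalerBl scale1r => h.
by rewrite scalerBr addrCA.
Qed.

Lemma convex_function_midpoint D (f : 'rV[R]_p -> R) x v : convex_function D f ->
  D (x + v) -> D (x - v) -> 2 * f x <= f (x + v) + f (x - v).
Proof.
move=> cf D1 D2.
have i0 : (0 : R) <= 2^-1 by rewrite invr_ge0.
have i1 : (2^-1 : R) <= 1 by rewrite invf_le1 // ler1n.
have := cf (Itv01 i0 i1) (x + v) (x - v); rewrite !inE => /(_ D1 D2).
rewrite convRE /conv /= /unstable.onem (_ : 1 - 2^-1 = 2^-1 :> R); last by lra.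
rewrite -!scalerDr addrACA subrr addr0 (_ : x + x = 2 *: x); last first.
  by rewrite scaler_nat mulr2n.
rewrite scalerA mulVf // scale1r /GRing.scale /=.
move: (f _) (f _) (f _) => A B C; lra.
Qed.

End Convexity.

Section LocalNorms.
Context {R : realType} {p : nat}.
Context (nu : R) (X D : set 'rV[R]_p) (f : 'rV[R]_p -> R).
Context (scb : self_concordant_barrier nu X D f).
Implicit Types (x y u v w : 'rV[R]_p) (s t r : R).

Let oD : open D := scb_open scb.
Let sD : continuously_differentiable 3 D f := scb_smooth scb.

Lemma open_line_ball x v : D x -> exists2 e, 0 < e & forall s, `|s| < e -> D (x + s *: v).
Proof.
move=> Dx; have Dx0 : D (x + 0 *: v) by rewrite scale0r addr0.
have /nbhs_ballP[e /= e0 he] := near_open_line oD Dx0.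
exists e => // s se; apply: he; by rewrite -ball_normE /= sub0r normrN.
Qed.

(** A negative second derivative makes the slope along [v] larger just before 0 than just after it;
    mean values on both sides then contradict midpoint convexity. *)
Lemma hess_ge0 x v : D x -> 0 <= dot (v *m hess f x) v.
Proof.
move=> Dx; rewrite leNgt; apply/negP => h0.
pose phi1 s := dot (grad f (x + s *: v)) v.
have d1 s : D (x + s *: v) -> is_derive s 1 phi1 (dot (v *m hess f (x + s *: v)) v).
  by move=> Ds; exact: (is_derive_grad_line oD sD).
have [e1 e10 h1] : exists2 e, 0 < e & forall s, 0 < s < e -> phi1 s < phi1 0 /\ phi1 0 < phi1 (- s).
  have := d1 0; rewrite scale0r addr0 => /(_ Dx) d10.
  exact: (is_derive_neg_lt d10 h0).
have [e2 e20 h2] := open_line_ball v Dx; clear h0.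
pose e := Num.min e1 e2 / 2.
have e_0 : 0 < e by rewrite divr_gt0 // lt_min e10.
have ee1 : e < e1.
  have : Num.min e1 e2 <= e1 by rewrite ge_min lexx.
  by rewrite /e; lra.
have ee2 : e < e2.
  have : Num.min e1 e2 <= e2 by rewrite ge_min lexx orbT.
  by rewrite /e; lra.
have De s : - e <= s <= e -> D (x + s *: v).
  by move=> /andP[? ?]; apply: h2; rewrite ltr_norml; apply/andP; split; lra.
pose phi s := f (x + s *: v).
have dphi s : - e <= s <= e -> is_derive s 1 phi (phi1 s).
  by move=> /De; exact: (is_derive_f_line oD sD).
have [||a /andP[a0 ae] ea] := @is_derive_mvt_oo _ phi phi1 0 e => //.
  by move=> s /andP[? ?]; apply: dphi; apply/andP; split; lra.
have [||b /andP[be b0] eb] := @is_derive_mvt_oo _ phi phi1 (- e) 0 => //.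
- by lra.
- by move=> s /andP[? ?]; apply: dphi; apply/andP; split; lra.
have [|p1 _] := h1 a; first by rewrite a0 (lt_trans ae).
have [|_ p2] := h1 (- b).
  by rewrite oppr_gt0 b0 ltrNl (lt_trans _ be) // ltrN2.
rewrite opprK in p2.
have := convex_function_midpoint (x := x) (v := e *: v) (scb_convex scb).
have De1 : D (x + e *: v) by apply: De; rewrite lexx andbT ge0_cp // ltW.
have De2 : D (x - e *: v) by rewrite -scaleNr; apply: De; rewrite lexx ge0_cp // ltW.
move=> /(_ De1 De2); rewrite -scaleNr -/(phi e) -/(phi (- e)).
have -> : f x = phi 0 by rewrite /phi scale0r addr0.
have k1 : phi1 a * e < phi1 0 * e by rewrite ltr_pM2r.
have k2 : phi1 0 * e < phi1 b * e by rewrite ltr_pM2r.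
move: ea eb k1 k2.
move: (phi e) (phi 0) (phi (-e)) (phi1 a) (phi1 b) (phi1 0) => A B C E F G; lra.
Qed.

Lemma lnorm_ge0 x v : 0 <= lnorm f x v.
Proof. exact: sqrtr_ge0. Qed.

Lemma sqr_lnorm x v : D x -> lnorm f x v ^+ 2 = dot (v *m hess f x) v.
Proof. by move=> Dx; rewrite sqr_sqrtr // hess_ge0. Qed.

Lemma lnormZ x r v : lnorm f x (r *: v) = `|r| * lnorm f x v.
Proof.
rewrite /lnorm -scalemxAl dotZl dotZr mulrA -expr2.
by rewrite sqrtrM ?sqr_ge0 // sqrtr_sqr.
Qed.

Lemma lnormN x v : lnorm f x (- v) = lnorm f x v.
Proof. by rewrite -scaleN1r lnormZ normrN1 mul1r. Qed.

Lemma lnorm0 x : lnorm f x 0 = 0.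
Proof. by rewrite -(scale0r 0) lnormZ normr0 mul0r. Qed.

Lemma lnormD x u v : D x -> lnorm f x (u + v) <= lnorm f x u + lnorm f x v.
Proof.
move=> Dx; apply: form_triangle => [a b|a]; first exact: (dot_hess_sym oD sD).
exact: hess_ge0.
Qed.

Lemma hess_cs x u v : D x -> `|dot (u *m hess f x) v| <= lnorm f x u * lnorm f x v.
Proof.
move=> Dx; apply: form_cs => [a b|a]; first exact: (dot_hess_sym oD sD).
exact: hess_ge0.
Qed.

Lemma third_le x v : D x -> `|third f x v v v| <= 2 * lnorm f x v ^+ 3.
Proof.
move=> Dx; have Dx0 : D (x + 0 *: v) by rewrite scale0r addr0.
have := scb_third scb (tau := 0) Dx Dx0.
cbv beta zeta; rewrite (derive2_line oD sD Dx0) (derive3_line oD sD Dx0) scale0r addr0.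
by rewrite powR32 ?hess_ge0 // -sqr_lnorm // sqrtr_sqr (ger0_norm (lnorm_ge0 x v)) -exprSr.
Qed.

Lemma nu_ge0 : D !=set0 -> 0 <= nu.
Proof.
move=> [x Dx]; have := scb_parameter scb 0 Dx.
by rewrite dot0r lnorm0 mulr0 expr0n subr0.
Qed.

(** The parameter inequality at all multiples [t *: v] is a nonnegative quadratic in [t], and its
    discriminant is the claim. *)
Lemma grad_le x v : D x -> `|dot (grad f x) v| <= Num.sqrt nu * lnorm f x v.
Proof.
move=> Dx; have n0 : 0 <= nu by apply: nu_ge0; exists x.
rewrite -(ger0_norm (lnorm_ge0 x v)) -[`|lnorm f x v|]sqrtr_sqr -sqrtrM // -sqrtr_sqr.
rewrite ler_wsqrtr // sqr_lnorm // -(sqrrN (dot _ _)).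
apply: discriminant_le => [|t]; first exact: hess_ge0.
have := scb_parameter scb (t *: v) Dx.
rewrite dotZr lnormZ exprMn sqr_lnorm // real_normK ?num_real //.
move: (dot _ _) (dot _ _) => A B; lra.
Qed.

(** Along the line the Hessian form satisfies [|h'| <= 2 h^(3/2)], so the inverse of the local norm
    of [u] is 1-Lipschitz. *)
Lemma lnorm_segment x u t : 0 <= t -> (forall s, 0 <= s <= t -> D (x + s *: u)) ->
  `|lnorm f x u - lnorm f (x + t *: u) u|
     <= t * (lnorm f x u * lnorm f (x + t *: u) u).
Proof.
move=> t0 Ds.
have := @sqrt_self_concordant _ (fun s => dot (u *m hess f (x + s *: u)) u)
  (fun s => third f (x + s *: u) u u u) 0 t t0.
rewrite scale0r addr0 subr0; apply.
- by move=> s /Ds; exact: (is_derive_hess_line oD sD).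
- by move=> s /Ds; exact: hess_ge0.
- move=> s /Ds Dsu; apply: (le_trans (third_le _ Dsu)).
  by rewrite -sqr_lnorm // sqrtr_sqr (ger0_norm (lnorm_ge0 _ _)) -mulrA -exprSr.
Qed.

Lemma lnorm_segment_le x u t : 0 <= t -> (forall s, 0 <= s <= t -> D (x + s *: u)) ->
  lnorm f (x + t *: u) u * (1 - t * lnorm f x u) <= lnorm f x u.
Proof.
move=> t0 /(lnorm_segment t0); rewrite ler_norml => /andP[+ _].
move: (lnorm f x u) (lnorm f _ u) => A B; lra.
Qed.

Lemma lnorm_segment_ge x u t : 0 <= t -> (forall s, 0 <= s <= t -> D (x + s *: u)) ->
  lnorm f x u <= lnorm f (x + t *: u) u * (1 + t * lnorm f x u).
Proof.
move=> t0 /(lnorm_segment t0); rewrite ler_norml => /andP[_].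
move: (lnorm f x u) (lnorm f _ u) => A B; lra.
Qed.

End LocalNorms.

(** * Dikin ellipsoid and barrier parameter *)

Section DikinEllipsoid.
Context {R : realType} {p : nat}.
Context (nu : R) (X D : set 'rV[R]_p) (f : 'rV[R]_p -> R).
Context (scb : self_concordant_barrier nu X D f).
Implicit Types (x y u v w : 'rV[R]_p) (s t r : R).

Let oD : open D := scb_open scb.
Let sD : continuously_differentiable 3 D f := scb_smooth scb.

Lemma line_near_left x u (T : R) (B : set 'rV[R]_p) : 0 < T -> nbhs (x + T *: u) B ->
  exists s, [/\ 0 <= s, s < T & B (x + s *: u)].
Proof.
move=> T0 nB; have cl : {for T, continuous (fun r : R => x + r *: u)}.
  by apply: continuousD; [exact: cst_continuous|exact: scalel_continuous].
have /nbhs_ballP[e /= e0 he] := cl _ nB.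
have m0 : 0 < Num.min e T by rewrite lt_min e0.
have m1 : Num.min e T <= e by rewrite ge_min lexx.
have m2 : Num.min e T <= T by rewrite ge_min lexx orbT.
exists (T - Num.min e T / 2); split; [lra|lra|].
apply: he; rewrite -ball_normE /= ltr_norml; apply/andP; split; lra.
Qed.

(** The exit time is the infimum of the parameters outside [D]. Since [D] is open, it is itself such
    a parameter, hence positive. *)
Lemma exit_time x u : D x -> ~ D (x + u) ->
  exists T : R, [/\ 0 < T, T <= 1, ~ D (x + T *: u) &
    forall s, 0 <= s -> s < T -> D (x + s *: u)].
Proof.
move=> Dx nD.
pose S : set R := [set s | 0 <= s /\ ~ D (x + s *: u)].
have S1 : S 1 by split => //; rewrite scale1r.
have lbS : has_lbound S by exists 0 => s [].
have S0 : S !=set0 by exists 1.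
have T0 : 0 <= inf S by apply: lb_le_inf => // s [].
have T1 : inf S <= 1 by apply: ge_inf.
have Ds s : 0 <= s -> s < inf S -> D (x + s *: u).
  move=> s0 sT; apply: contrapT => nDs.
  by have := ge_inf lbS (conj s0 nDs : S s); rewrite leNgt sT.
have nDT : ~ D (x + inf S *: u).
  move=> DT; have /nbhs_ballP[e /= e0 he] := near_open_line oD DT.
  have [s [s0 nDs] se] := inf_adherent e0 (conj S0 lbS).
  have iS : inf S <= s by exact: ge_inf.
  apply: nDs; apply: he; rewrite -ball_normE /= ltr_norml; apply/andP; split; lra.
exists (inf S); split => //.
rewrite lt_neqAle T0 andbT; apply/eqP => T00.
by apply: nDT; rewrite -T00 scale0r addr0.
Qed.

Lemma exit_unbounded x u (T M : R) : 0 < T -> ~ D (x + T *: u) ->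
  (forall s, 0 <= s -> s < T -> D (x + s *: u)) ->
  exists s, [/\ 0 <= s, s < T & M <= f (x + s *: u)].
Proof.
move=> T0 nDT Ds.
have clT : closure D (x + T *: u).
  move=> B nB; have [s [s0 sT Bs]] := line_near_left T0 nB.
  by exists (x + s *: u); split => //; apply: Ds.
have lim := scb_boundary scb clT nDT.
have : \forall z \near within D (nbhs (x + T *: u)), M <= f z.
  by move/cvgryPge: lim; apply.
rewrite near_withinE => nM.
have [s [s0 sT Ms]] := line_near_left T0 nM.
by exists s; split => //; apply: Ms; apply: Ds.
Qed.

(** The bound [B ^+ 2] on the second derivative is integrated twice. A crude bound suffices, as it
    only has to contradict the blow-up of [f]. *)
Lemma line_bound x u t B : 0 <= t <= 1 -> (forall s, 0 <= s <= t -> D (x + s *: u)) ->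
  (forall s, 0 <= s <= t -> lnorm f (x + s *: u) u <= B) ->
  f (x + t *: u) <= f x + (`|dot (grad f x) u| + B ^+ 2).
Proof.
move=> /andP[t0 t1] Ds LB.
pose K := `|dot (grad f x) u| + B ^+ 2.
have g s : 0 <= s <= t -> dot (grad f (x + s *: u)) u <= K.
  move=> /andP[s0 st].
  have in_ r : 0 <= r <= s -> 0 <= r <= t.
    by move=> /andP[-> rs]; exact: le_trans rs st.
  have := @is_derive_le _ (fun r => dot (grad f (x + r *: u)) u)
    (fun r => dot (u *m hess f (x + r *: u)) u)
    (fun r => B ^+ 2 * r) (fun=> B ^+ 2) 0 s s0.
  case/(_ _ _ _)/Wrap => [r rs|r rs|r rs|].
  - exact: (is_derive_grad_line oD sD _ (Ds _ (in_ _ rs))).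
  - exact: is_derive_mull.
  - rewrite -(sqr_lnorm scb _ (Ds _ (in_ _ rs))) ler_sqr ?nnegrE ?sqrtr_ge0 //.
      exact: LB (in_ _ rs).
    exact: le_trans (lnorm_ge0 _ _ _) (LB _ (in_ _ rs)).
  rewrite scale0r addr0 mulr0 subr0 /K.
  have : B ^+ 2 * s <= B ^+ 2 * 1.
    by rewrite ler_wpM2l ?sqr_ge0 // (le_trans st).
  have := ler_norm (dot (grad f x) u).
  move: (dot _ _) (dot _ _) `|_| => a b c; lra.
have K0 : 0 <= K by rewrite addr_ge0 ?sqr_ge0.
have := @is_derive_le _ (fun r => f (x + r *: u)) (fun r => dot (grad f (x + r *: u)) u)
  (fun r => K * r) (fun=> K) 0 t t0.
case/(_ _ _ _)/Wrap => [r rs|r rs|r rs|].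
- exact: (is_derive_f_line oD sD (Ds _ rs)).
- exact: is_derive_mull.
- exact: g.
rewrite scale0r addr0 mulr0 subr0.
have : K * t <= K * 1 by rewrite ler_wpM2l.
rewrite -/K; move: (f _) (f _) => a b; lra.
Qed.

(** Up to an exit time the local norm of [u] would stay below [B = r / (1 - r)], with [r] its value
    at [x]; so [f] would stay bounded, although it is unbounded towards an exit point. *)
Lemma dikin x u : D x -> lnorm f x u < 1 -> D (x + u).
Proof.
move=> Dx u1; apply: contrapT => nD.
have [T [T0 T1 nDT Ds]] := exit_time Dx nD.
pose B := lnorm f x u / (1 - lnorm f x u).
have [s [s0 sT]] := exit_unbounded (f x + (`|dot (grad f x) u| + B ^+ 2) + 1) T0 nDT Ds.
apply/negP; rewrite -ltNge.
have s1 : s <= 1 by rewrite (le_trans (ltW sT)).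
have s01 : 0 <= s <= 1 by rewrite s0.
have Ds' r : 0 <= r <= s -> D (x + r *: u).
  by move=> /andP[r0 rs]; apply: Ds => //; exact: le_lt_trans rs sT.
apply: (le_lt_trans (line_bound (B := B) s01 Ds' _)); last by rewrite ltrDl.
move=> r /andP[r0 rs].
have Dr q : 0 <= q <= r -> D (x + q *: u).
  by move=> /andP[q0 qr]; apply: Ds'; rewrite q0 (le_trans qr).
rewrite ler_pdivlMr ?subr_gt0 //.
apply: le_trans (lnorm_segment_le scb r0 Dr).
apply: ler_wpM2l; first exact: lnorm_ge0.
by rewrite lerD2l lerN2 ler_piMl ?lnorm_ge0 // (le_trans rs).
Qed.

End DikinEllipsoid.

Lemma continuous_dot (R : realType) (p : nat) (b : 'rV[R]_p) : continuous (dot b).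
Proof.
move=> x; apply: differentiable_continuous.
rewrite (_ : dot b = \sum_(i < p) (fun y : 'rV[R]_p => b 0 i *: (y 0 i : R))).
  apply: differentiable_sum => i; apply: differentiableZ.
  exact: differentiable_coord.
by apply/funext => y; rewrite fct_sumE.
Qed.

Lemma closure_dot_le (R : realType) (p : nat) (D : set 'rV[R]_p) (b x : 'rV[R]_p) (M : R) :
  (forall y, D y -> dot b (y - x) <= M) -> forall y, closure D y -> dot b (y - x) <= M.
Proof.
move=> h y cy; rewrite leNgt; apply/negP => Mlt.
rewrite dotBr in Mlt.
have e0 : 0 < dot b y - dot b x - M by rewrite subr_gt0.
have c : {for y, continuous (dot b)} by exact: continuous_dot.
have : \forall z \near y, `|dot b y - dot b z| < dot b y - dot b x - M.
  by move/cvgrPdist_lt: c; apply.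
move=> /cy [z [Dz /=]]; have := h z Dz; rewrite dotBr ltr_norml => + /andP[_].
by move: (dot _ _) (dot _ _) (dot _ _) => A B C; lra.
Qed.

(** * Consequences of the barrier parameter *)

Section BarrierParameter.
Context {R : realType} {p : nat}.
Context (nu : R) (X D : set 'rV[R]_p) (f : 'rV[R]_p -> R).
Context (scb : self_concordant_barrier nu X D f).
Implicit Types (x y u v w : 'rV[R]_p) (s t r : R).

Let oD : open D := scb_open scb.
Let cD : convex_set D := scb_convex_dom scb.
Let sD : continuously_differentiable 3 D f := scb_smooth scb.

Lemma segment_in x u s : D x -> D (x + u) -> 0 <= s <= 1 -> D (x + s *: u).
Proof.
move=> Dx Du s01; have := convex_set_segment cD Dx Du s01.
by rewrite addrAC subrr add0r.
Qed.

Lemma grad_line_nondecreasing x u s t : D x -> D (x + u) ->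
  0 <= s -> s <= t -> t <= 1 ->
  dot (grad f (x + s *: u)) u <= dot (grad f (x + t *: u)) u.
Proof.
move=> Dx Du s0 st t1.
have Dr r : s <= r <= t -> D (x + r *: u).
  by move=> /andP[sr rt]; apply: segment_in => //; rewrite (le_trans s0) ?(le_trans rt).
apply: (@is_derive_ge0_le _ (fun r => dot (grad f (x + r *: u)) u)
    (fun r => dot (u *m hess f (x + r *: u)) u) _ _ st) => r /Dr Dr'.
  exact: (is_derive_grad_line oD sD _ Dr').
exact: (hess_ge0 scb).
Qed.

(** The slope [g] satisfies [g^2 <= nu g'], so [- 1 / g] grows at rate at least [1 / nu] once [g] is
    positive; integrate from [t] to 1, where it is still negative. *)
Lemma grad_line_le x u t : D x -> D (x + u) -> 0 <= t -> t < 1 ->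
  dot (grad f (x + t *: u)) u * (1 - t) <= nu.
Proof.
move=> Dx Du t0 t1; have n0 : 0 <= nu by apply: (nu_ge0 scb); exists x.
pose g s := dot (grad f (x + s *: u)) u.
pose h s := dot (u *m hess f (x + s *: u)) u.
rewrite -/(g t); have [gt0|gt0] := lerP (g t) 0.
  by apply: le_trans n0; rewrite mulr_le0_ge0 // subr_ge0 ltW.
have gs s : t <= s <= 1 -> 0 < g s.
  move=> /andP[ts s1]; apply: (lt_le_trans gt0).
  exact: grad_line_nondecreasing.
have Ds s : t <= s <= 1 -> D (x + s *: u).
  by move=> /andP[sr rt]; apply: segment_in => //; rewrite (le_trans t0).
have gh s : t <= s <= 1 -> g s ^+ 2 <= nu * h s.
  move=> ts; have := grad_le scb u (Ds _ ts); rewrite -/(g s).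
  rewrite -ler_sqr ?nnegrE ?mulr_ge0 ?sqrtr_ge0 ?normr_ge0 //.
  by rewrite exprMn sqr_sqrtr // (sqr_lnorm scb _ (Ds _ ts)) real_normK ?num_real.
have hnu : 0 < nu.
  rewrite lt_neqAle n0 andbT; apply/eqP => nu0.
  have tt : t <= t <= 1 by rewrite lexx ltW.
  have := gh t tt; rewrite -nu0 mul0r leNgt.
  by rewrite exprn_gt0.
have dg s : t <= s <= 1 -> is_derive s 1 (fun r => - (g r)^-1) (h s / g s ^+ 2).
  move=> ts; have gs0 : g s != 0 by rewrite gt_eqF ?gs.
  have d1 : is_derive s 1 g (h s) := is_derive_grad_line oD sD u (Ds _ ts).
  have d2 := is_deriveV gs0 d1.
  have d3 : is_derive s 1 (- (fun r => (g r)^-1)) (- (- (g s) ^- 2 *: h s)).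
    exact: is_deriveN.
  apply: (is_derive_eq d3).
  by rewrite /GRing.scale /= mulNr opprK mulrC.
have := @is_derive_le _ (fun s => nu^-1 * s) (fun=> nu^-1)
  (fun r => - (g r)^-1) (fun s => h s / g s ^+ 2) t 1 (ltW t1).
have b1 s : t <= s <= 1 -> nu^-1 <= h s / g s ^+ 2.
  move=> ts; rewrite ler_pdivlMr ?exprn_gt0 ?gs // mulrC ler_pdivrMr // mulrC.
  exact: gh.
move=> /(_ (fun s _ => is_derive_mull nu^-1 s) dg b1).
have g1 : 0 < (g 1)^-1 by rewrite invr_gt0 gs // ltW //= lexx.
move=> le1; have : (1 - t) / nu <= (g t)^-1.
  by move: le1 g1; move: (g 1)^-1 (g t)^-1 => a b; lra.
by rewrite ler_pdivrMr // mulrC -ler_pdivrMr ?invr_gt0 // invrK mulrC.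
Qed.

(** With [r] the local norm of [u] at [x], the one at [x + s *: u] is at least [r / (1 + r s)].
    Integrating its square bounds the growth of the slope on [[0, t]], and [grad_line_le] bounds the
    slope at [t]. *)
Lemma grad_segment_le x u t : D x -> D (x + u) -> 0 <= t -> t < 1 ->
  dot (grad f x) u + lnorm f x u * (lnorm f x u * t) / (1 + lnorm f x u * t)
    <= nu / (1 - t).
Proof.
move=> Dx Du t0 t1; set r := lnorm f x u.
have r0 : 0 <= r by exact: lnorm_ge0.
have Ds s : 0 <= s <= t -> D (x + s *: u).
  move=> /andP[s0 st]; apply: segment_in => //; rewrite s0.
  exact: le_trans st (ltW t1).
have rs0 s : 0 <= s -> 0 < 1 + r * s by move=> s0; rewrite ltr_pwDl // mulr_ge0.
have := @is_derive_le _ (fun s => - r * (1 + r * s)^-1) (fun s => r ^+ 2 / (1 + r * s) ^+ 2)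
  (fun s => dot (grad f (x + s *: u)) u) (fun s => dot (u *m hess f (x + s *: u)) u) 0 t t0.
have A s : 0 <= s <= t -> is_derive s 1 (fun s => - r * (1 + r * s)^-1) (r ^+ 2 / (1 + r * s) ^+ 2).
  move=> /andP[s0 _]; have d1 := is_derive_shiftV (lt0r_neq0 (rs0 _ s0)).
  have d2 : is_derive s 1 (- r *: (fun s => (1 + r * s)^-1)) (- r *: (- r / (1 + r * s) ^+ 2)).
    exact: is_deriveZ.
  apply: (is_derive_eq d2).
  by rewrite /GRing.scale /= mulrA mulrNN expr2.
have B s : 0 <= s <= t ->
    is_derive s 1 (fun s => dot (grad f (x + s *: u)) u) (dot (u *m hess f (x + s *: u)) u).
  by move=> /Ds; exact: is_derive_grad_line.
have C s : 0 <= s <= t -> r ^+ 2 / (1 + r * s) ^+ 2 <= dot (u *m hess f (x + s *: u)) u.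
  move=> /andP[s0 st]; rewrite -(sqr_lnorm scb _ (Ds s _)); last by rewrite s0.
  have p1 : 0 <= r / (1 + r * s) := divr_ge0 r0 (ltW (rs0 _ s0)).
  rewrite -expr_div_n (ler_sqr p1 (lnorm_ge0 _ _ _)).
  have Dq q : 0 <= q <= s -> D (x + q *: u).
    by move=> /andP[q0 qs]; apply: Ds; rewrite q0 (le_trans qs).
  have := lnorm_segment_ge scb s0 Dq; rewrite -/r (mulrC s) => key.
  by rewrite (ler_pdivrMr _ _ (rs0 _ s0)).
move=> /(_ A B C); rewrite scale0r addr0 mulr0 addr0 invr1 mulr1 => h1.
have := grad_line_le Dx Du t0 t1; rewrite -ler_pdivlMr ?subr_gt0 //.
apply: le_trans.
have -> : r * (r * t) / (1 + r * t) = - r * (1 + r * t)^-1 + r.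
  by field; rewrite gt_eqF ?rs0.
move: h1; move: (dot _ _) (dot _ _) (_ * _^-1) => a b c; lra.
Qed.

Lemma grad_le_nu x u : D x -> D (x + u) -> dot (grad f x) u <= nu.
Proof.
move=> Dx Du; have := grad_segment_le Dx Du (lexx 0) ltr01.
by rewrite !mulr0 mul0r addr0 subr0 divr1.
Qed.

(* The minimum over [b >= 0] of [nu / (1 - b / r) - r b / (1 + b) + F r] is
   replaced by its value at [b = F / (1 - F)], where the terms linear in [r]
   cancel; for [r <= sqrt nu / (1 - F)] the choice [b = 0] is better. *)
Lemma perturbed_grad_le x u w (F : R) : 1 <= nu -> 0 <= F -> F < 1 -> D x -> D (x + u) ->
  (forall v, `|dot w v| <= F * lnorm f x v) ->
  dot (grad f x + w) u <= nu + Num.sqrt nu * (F / (1 - F)).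
Proof.
move=> nu1 F0 F1 Dx Du wF; rewrite dotDl.
have {wF} := le_trans (ler_norm _) (wF u).
have := grad_le_nu Dx Du; have := @grad_segment_le x u _ Dx Du.
set r := lnorm f x u; have r0 : 0 <= r by exact: lnorm_ge0.
move: (dot _ _) (dot _ _) => g h gs gnu hF.
have n0 : 0 <= nu by exact: le_trans nu1.
set q := Num.sqrt nu; have q1 : 1 <= q by rewrite -[leLHS]sqrtr1 ler_wsqrtr.
have qq : nu = q * q by rewrite -expr2 sqr_sqrtr.
have F1' : 0 < 1 - F by rewrite subr_gt0.
have [rq|rq] := lerP (r * (1 - F)) q.
  have : F * r <= q * (F / (1 - F)).
    by rewrite mulrA ler_pdivlMr // -mulrA [q * F]mulrC ler_wpM2l.
  by lra.
pose b := F / (1 - F).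
have b0 : 0 <= b by rewrite divr_ge0 // ltW.
have rb : (q - F) / (1 - F) < r - b.
  by rewrite /b mulrBl ltrD2r ltr_pdivrMr.
have qF : 0 < q - F by lra.
have rb0 : 0 < r - b by apply: lt_trans rb; rewrite divr_gt0.
have rgt0 : 0 < r by lra.
have := gs (b / r) (divr_ge0 b0 r0).
rewrite ltr_pdivrMr // mul1r -subr_gt0 => /(_ rb0).
have -> : r * (r * (b / r)) / (1 + r * (b / r)) = r * F.
  by rewrite /b; field; rewrite !gt_eqF //; lra.
have -> : nu / (1 - b / r) = nu + nu * b / (r - b).
  by field; rewrite !gt_eqF.
move=> g1.
suff : nu * b / (r - b) <= q * (F / (1 - F)) by rewrite -/b; lra.
rewrite ler_pdivrMr //; apply: (@le_trans _ _ (q * b * ((q - F) / (1 - F)))); last first.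
  by apply: ler_wpM2l (ltW rb); rewrite mulr_ge0 // (le_trans ler01).
rewrite qq -mulrA -mulrA ler_wpM2l ?(le_trans ler01) // mulrC ler_wpM2l //.
rewrite ler_pdivlMr //; have : 0 <= F * (q - 1) by rewrite mulr_ge0 // subr_ge0.
by lra.
Qed.

(** Near the analytical center the slope at [x] is at least [- kappa r], while [grad_segment_le]
    forces a linear decrease in [r] far away. The parameter [z] is free; [z = sqrt nu] yields
    [nu + 2 sqrt nu]. *)
Lemma domain_bounded x u (kappa z : R) : 0 <= kappa -> kappa < 1 -> 0 < z -> D x -> D (x + u) ->
  (forall v, `|dot (grad f x) v| <= kappa * lnorm f x v) ->
  lnorm f x u <= (nu + kappa + z + nu / z) / (1 - kappa).
Proof.
move=> k0 k1 z0 Dx Du gk.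
have n0 : 0 <= nu by apply: (nu_ge0 scb); exists x.
have := gk u; have := @grad_segment_le x u _ Dx Du.
set r := lnorm f x u; have r0 : 0 <= r by exact: lnorm_ge0.
move: (dot _ _) => g gs; rewrite ler_norml => /andP[g1 _].
have k1' : 0 < 1 - kappa by rewrite subr_gt0.
rewrite ler_pdivlMr //.
have nz : 0 <= nu / z by rewrite divr_ge0 // ltW.
(* Then [b / (1 + b) = (z + kappa) / (1 + z)], which exceeds [kappa] by
   [z (1 - kappa) / (1 + z)]. *)
pose b := (z + kappa) / (1 - kappa).
have b0 : 0 < b by rewrite divr_gt0 // ltr_pwDl.
have [rb|rb] := lerP r b.
  have : r * (1 - kappa) <= z + kappa by rewrite -ler_pdivlMr.
  by lra.
have rgt0 : 0 < r by exact: lt_trans rb.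
have := gs (b / r) (divr_ge0 (ltW b0) r0).
rewrite ltr_pdivrMr // mul1r => /(_ rb).
have -> : r * (r * (b / r)) / (1 + r * (b / r)) = r * ((z + kappa) / (1 + z)).
  by rewrite /b; field; rewrite !gt_eqF //; lra.
have rb0 : 0 < r - b by lra.
have -> : nu / (1 - b / r) = r * (nu / (r - b)).
  by field; rewrite !gt_eqF.
move=> g2.
have : r * ((z + kappa) / (1 + z) - kappa) <= r * (nu / (r - b)) by lra.
rewrite ler_pM2l // ler_pdivlMr //.
have -> : ((z + kappa) / (1 + z) - kappa) * (r - b)
    = (r * (1 - kappa) - (z + kappa)) * (z / (1 + z)).
  by rewrite /b; field; rewrite !gt_eqF //; lra.
have z1 : 0 < z / (1 + z) by rewrite divr_gt0 // ltr_pwDl // ltW.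
rewrite -(ler_pdivlMr _ _ z1) => g3.
have e : nu / (z / (1 + z)) = nu / z + nu by field; rewrite !gt_eqF //; lra.
by move: g3; rewrite e; move: (nu / z) => ?; lra.
Qed.

(* Near the exit time [T] of a ray, the Dikin ellipsoid forces
   [lnorm >= 1 / (T - t)], so that [1 / (T - t)] bounds the directional
   derivative from below up to a constant, and [nu / (T - t)] from above. *)
Lemma nu_ge1 x u : D x -> ~ D (x + u) -> 1 <= nu.
Proof.
move=> Dx nDu; have [T [T0 T1 nDT Ds]] := exit_time scb Dx nDu.
pose g s := dot (grad f (x + s *: u)) u.
have n0 : 0 <= nu by apply: (nu_ge0 scb); exists x.
have lower t : 0 <= t -> t < T -> 1 <= lnorm f (x + t *: u) u * (T - t).
  move=> t0 tT; rewrite leNgt; apply/negP => lt1; apply: nDT.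
  have -> : x + T *: u = x + t *: u + (T - t) *: u.
    by rewrite -addrA -scalerDl subrKC.
  apply: (dikin scb); first exact: Ds.
  by rewrite lnormZ ger0_norm ?subr_ge0 ?(ltW tT) // mulrC.
have upper t : 0 <= t -> t < T -> g t * (T - t) <= nu.
  (* [grad_line_le] wants the far end in [D], hence [t' < T]. The bound passes to [T] by
     contradiction, with [t' - t] halfway between [nu / g t] and [T - t]. *)
  move=> t0 tT; have up t' : t < t' -> t' < T -> g t * (t' - t) <= nu.
    move=> tt' t'T; have t'0 : 0 < t' by exact: le_lt_trans tt'.
    have := @grad_line_le x (t' *: u) (t / t') Dx (Ds _ (ltW t'0) t'T) (divr_ge0 t0 (ltW t'0)).
    rewrite ltr_pdivrMr // mul1r => /(_ tt').
    rewrite scalerA divfK ?gt_eqF // dotZr -/(g t).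
    by apply: le_trans; rewrite le_eqVlt; apply/orP; left; apply/eqP; field; rewrite gt_eqF.
  rewrite leNgt; apply/negP => ngt.
  have Tt : 0 < T - t by rewrite subr_gt0.
  have gt0 : 0 < g t by have := le_lt_trans n0 ngt; rewrite pmulr_lgt0.
  have dl : nu / g t < T - t by rewrite ltr_pdivrMr // mulrC.
  have dn : 0 <= nu / g t by rewrite divr_ge0 // ltW.
  have := up (t + (nu / g t + (T - t)) / 2).
  rewrite addrAC subrr add0r => /(_ _ _)/Wrap[||]; [lra|lra|].
  rewrite mulrC -ler_pdivlMr //.
  by move: (nu / g t) dl dn => a; lra.
have diff t : 0 <= t -> t < T -> (T - t)^-1 - T^-1 <= g t - g 0.
  move=> t0 tT.
  have sT s : 0 <= s <= t -> 0 < T - s by move=> /andP[_ st]; rewrite subr_gt0 (le_lt_trans st).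
  have D1 s : 0 <= s <= t -> D (x + s *: u).
    by move=> /andP[s0 st]; apply: Ds => //; exact: le_lt_trans tT.
  have A s : 0 <= s <= t -> is_derive s 1 (fun s => (T + (- 1) * s)^-1) ((T - s) ^- 2).
    move=> /sT s0; have s1 : T + (- 1) * s != 0 by rewrite mulN1r gt_eqF.
    apply: (is_derive_eq (is_derive_shiftV s1)).
    by rewrite opprK mulN1r mul1r.
  have B s : 0 <= s <= t -> is_derive s 1 g (dot (u *m hess f (x + s *: u)) u).
    by move=> /D1 Dsu; exact: (is_derive_grad_line oD sD _ Dsu).
  have C s : 0 <= s <= t -> (T - s) ^- 2 <= dot (u *m hess f (x + s *: u)) u.
    move=> s0t; have s0 := sT _ s0t; rewrite -(sqr_lnorm scb _ (D1 _ s0t)).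
    have i0 : 0 <= (T - s)^-1 by rewrite invr_ge0 ltW.
    rewrite -exprVn (ler_sqr i0 (lnorm_ge0 _ _ _)) -[leLHS]mul1r (ler_pdivrMr _ _ s0).
    by case/andP: s0t => s0' st; apply: lower => //; exact: le_lt_trans tT.
  have := is_derive_le t0 A B C.
  by rewrite mulr0 addr0 mulN1r.
rewrite leNgt; apply/negP => nu1.
pose K := `|g 0 - T^-1|.
have K0 : 0 <= K by exact: normr_ge0.
(* This makes [1 - K e > nu], contradicting [upper] at distance [e] from the exit time. *)
pose e := Num.min T ((1 - nu) / (2 * (K + 1))).
have K1 : 0 < 2 * (K + 1) by lra.
have e0 : 0 < e by rewrite lt_min T0 divr_gt0 // subr_gt0.
have eT : e <= T by rewrite ge_min lexx.
have eK : e * (2 * (K + 1)) <= 1 - nu by rewrite -ler_pdivlMr // ge_min lexx orbT.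
have t0 : 0 <= T - e by rewrite subr_ge0.
have tT : T - e < T by rewrite ltrBlDr ltrDl.
have h1 := upper _ t0 tT; have h2 := diff _ t0 tT.
rewrite subKr in h1 h2.
have h3 : - K <= g 0 - T^-1 by rewrite /K lerNl -normrN ler_norm.
have h4 : (e^-1 - K) * e <= g (T - e) * e by rewrite ler_pM2r //; lra.
rewrite mulrBl mulVf ?gt_eqF // in h4.
have : 0 <= K * e by rewrite mulr_ge0 // ltW.
by clear h2 h3; lra.
Qed.

End BarrierParameter.

(** * Comparison of Hessians and gradients *)

Section ThirdDerivativeScalars.
Context {R : realType}.
Implicit Types (a b e m n : R).

(** The extreme case is [{a, b} = {1/2, 3/2}], where both constraints and the conclusion are
    equalities. *)
Lemma sum_cubes_le a b : 0 <= a -> 0 <= b -> a <= 3 / 2 -> b <= 3 / 2 ->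
  a ^+ 2 + b ^+ 2 <= 5 / 2 -> a ^+ 3 + b ^+ 3 <= 7 / 2.
Proof.
have small x : 0 <= x -> x <= 2^-1 -> x ^+ 3 <= 8^-1 :> R.
  move=> x0 x1; have : x ^+ 3 <= (2^-1) ^+ 3 by rewrite lerXn2r ?nnegrE ?invr_ge0.
  by move/le_trans; apply; lra.
have big x : 0 <= x -> x <= 3 / 2 -> x ^+ 3 <= 27 / 8 :> R.
  move=> x0 x1; have : x ^+ 3 <= (3 / 2) ^+ 3 by rewrite lerXn2r ?nnegrE //; lra.
  by move/le_trans; apply; lra.
(* On [1/2, 3/2] the function x^(3/2) of x^2 lies below its chord. *)
have chord x : 2^-1 <= x -> x <= 3 / 2 -> x ^+ 3 <= 13 / 8 * x ^+ 2 - 9 / 32 :> R.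
  move=> x0 x1; have : 0 <= (x - 2^-1) * ((3 / 2 - x) * (x + 3 / 8)).
    by rewrite mulr_ge0 ?mulr_ge0 //; lra.
  by lra.
move=> a0 b0 a1 b1 ab.
have [sa|/ltW la] := lerP a 2^-1.
  by have := small _ a0 sa; have := big _ b0 b1; lra.
have [sb|/ltW lb] := lerP b 2^-1.
  by have := small _ b0 sb; have := big _ a0 a1; lra.
by have := chord _ la a1; have := chord _ lb b1; lra.
Qed.

(** Lets homogeneity be used with strict upper bounds of seminorms, which are positive and can be
    divided by even when the seminorms vanish. *)
Lemma le_mul_sqr_of_gt (K t m n : R) : 0 <= K -> 0 <= m -> 0 <= n ->
  (forall a b, m < a -> n < b -> t <= K * (a * b ^+ 2)) -> t <= K * (m * n ^+ 2).
Proof.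
move=> K0 m0 n0 h; apply/ler_addgt0Pr => e e0.
pose M := 1 + K * ((n + 1) ^+ 2 + m * (2 * n + 1)).
have M0 : 0 < M.
  by rewrite ltr_pwDl // mulr_ge0 // addr_ge0 ?sqr_ge0 // mulr_ge0 //; lra.
pose d := Num.min 1 (e / M).
have d0 : 0 < d by rewrite lt_min ltr01 divr_gt0.
have d1 : d <= 1 by rewrite ge_min lexx.
have dM : d * M <= e by rewrite -ler_pdivlMr // ge_min lexx orbT.
clearbody d; have md : m < m + d by rewrite ltrDl.
have nd : n < n + d by rewrite ltrDl.
apply: (le_trans (h _ _ md nd)).
have p1 : (m + d) * (n + d) ^+ 2 <= m * n ^+ 2 + d * ((n + 1) ^+ 2 + m * (2 * n + 1)).
  have q1 : d * (n + d) ^+ 2 <= d * (n + 1) ^+ 2.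
    by rewrite ler_pM2l // lerXn2r ?nnegrE ?lerD2l // addr_ge0 // ltW.
  have q2 : m * (d * d) <= m * (d * 1) by rewrite ler_wpM2l // ler_pM2l.
  by clear -q1 q2; lra.
apply: (le_trans (ler_wpM2l K0 p1)).
move: dM; rewrite /M mulrDr mulr1 => dM.
by clear -dM d0; lra.
Qed.

(** The two cubes are those of [v + u/2] and [v - u/2]; their difference is [3 C + A / 4], so
    [3 |C| <= 7 + 1/2]. *)
Lemma polarization_le (A B C E a b n : R) :
  `|(2^-1) ^+ 3 * A + 3 * (2^-1) ^+ 2 * B + 3 * 2^-1 * C + E| <= 2 * a ->
  `|(- 2^-1) ^+ 3 * A + 3 * (- 2^-1) ^+ 2 * B + 3 * (- 2^-1) * C + E| <= 2 * b ->
  `|A| <= 2 * n -> n <= 1 -> a + b <= 7 / 2 -> `|C| <= 5 / 2.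
Proof.
rewrite !ler_norml => /andP[? ?] /andP[? ?] /andP[? ?] ? ?.
by apply/andP; split; lra.
Qed.

Lemma half_add_le a b : a <= 1 -> b <= 1 -> 2^-1 * a + b <= 3 / 2.
Proof. lra. Qed.

Lemma parallelogram_le (A B C : R) : A <= 1 -> C <= 1 ->
  2^-1 * (2^-1 * A) + 2^-1 * B + (2^-1 * B + C)
    + (- 2^-1 * (- 2^-1 * A) + - 2^-1 * B + (- 2^-1 * B + C)) <= 5 / 2.
Proof. lra. Qed.

End ThirdDerivativeScalars.

Section ThirdDerivative.
Context {R : realType} {p : nat}.
Context (nu : R) (X D : set 'rV[R]_p) (f : 'rV[R]_p -> R).
Context (scb : self_concordant_barrier nu X D f).
Implicit Types (x y u v w : 'rV[R]_p) (s t r : R).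

Let oD : open D := scb_open scb.
Let sD : continuously_differentiable 3 D f := scb_smooth scb.

Lemma third_cube x (c : R) u v : D x ->
  third f x (c *: u + v) (c *: u + v) (c *: u + v)
    = c ^+ 3 * third f x u u u + 3 * c ^+ 2 * third f x v u u
      + 3 * c * third f x u v v + third f x v v v.
Proof.
move=> Dx.
have s12 a b d := third_sym12 oD sD a b d Dx.
have s23 a b d := third_sym23 oD sD a b d Dx.
have l1 a b := third_linear sD c u v a b Dx.
move: (third f x) s12 s23 l1 => T s12 s23 l1.
have l2 a b : T a (c *: u + v) b = c * T a u b + T a v b.
  by rewrite s12 l1 (s12 u a b) (s12 v a b).
have l3 a b : T a b (c *: u + v) = c * T a b u + T a b v.
  by rewrite s23 l2 (s23 a u b) (s23 a v b).
rewrite l1 !l2 !l3 (s23 u u v) (s12 u v u) (s12 v u v) (s23 v v u) (s12 v u v).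
move: (T u u u) (T v u u) (T u v v) (T v v v) => A B C E; ring.
Qed.

Lemma third_le_unit x u v : D x -> lnorm f x u <= 1 -> lnorm f x v <= 1 ->
  `|third f x u v v| <= 5 / 2.
Proof.
move=> Dx u1 v1.
have a1 : lnorm f x (2^-1 *: u + v) <= 3 / 2.
  apply: (le_trans (lnormD scb _ _ Dx)); rewrite lnormZ ger0_norm ?invr_ge0 //.
  exact: half_add_le.
have b1 : lnorm f x (- 2^-1 *: u + v) <= 3 / 2.
  apply: (le_trans (lnormD scb _ _ Dx)); rewrite lnormZ normrN ger0_norm ?invr_ge0 //.
  exact: half_add_le.
have sq w : lnorm f x w <= 1 -> dot (w *m hess f x) w <= 1.
  by move=> w1; rewrite -(sqr_lnorm scb w Dx) expr_le1 ?lnorm_ge0.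
have ab : lnorm f x (2^-1 *: u + v) ^+ 2 + lnorm f x (- 2^-1 *: u + v) ^+ 2 <= 5 / 2.
  rewrite !(sqr_lnorm scb _ Dx).
  rewrite !mulmxDl -!scalemxAl !dotDl !dotDr !dotZl !dotZr.
  rewrite (dot_hess_sym oD sD v u Dx).
  have := parallelogram_le (dot (u *m hess f x) v) (sq _ u1) (sq _ v1).
  by apply: le_trans; rewrite le_eqVlt; apply/orP; left; apply/eqP; congr (_ + _); ring.
have := third_le scb (- 2^-1 *: u + v) Dx; rewrite (third_cube _ _ _ Dx) => cb.
have := third_le scb (2^-1 *: u + v) Dx; rewrite (third_cube _ _ _ Dx) => ca.
apply: (polarization_le ca cb (third_le scb u Dx)).
  by rewrite expr_le1 ?lnorm_ge0.
exact: (sum_cubes_le (lnorm_ge0 _ _ _) (lnorm_ge0 _ _ _) a1 b1 ab).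
Qed.

(* Banach's theorem on symmetric trilinear forms would give 2 instead of 5/2. *)
Lemma third_le_mixed x u v : D x ->
  `|third f x u v v| <= 5 / 2 * (lnorm f x u * lnorm f x v ^+ 2).
Proof.
move=> Dx; apply: le_mul_sqr_of_gt; [lra|exact: lnorm_ge0|exact: lnorm_ge0|].
move=> a b ua vb.
have a0 : 0 < a by exact: le_lt_trans (lnorm_ge0 _ _ _) ua.
have b0 : 0 < b by exact: le_lt_trans (lnorm_ge0 _ _ _) vb.
have scale z q : 0 < q -> lnorm f x z < q -> lnorm f x (q^-1 *: z) <= 1.
  move=> q0 zq; rewrite lnormZ gtr0_norm ?invr_gt0 // mulrC ler_pdivrMr // mul1r.
  exact: ltW.
have := third_le_unit Dx (scale _ _ a0 ua) (scale _ _ b0 vb).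
have e : third f x (a^-1 *: u) (b^-1 *: v) (b^-1 *: v) = (a * b ^+ 2)^-1 * third f x u v v.
  rewrite (thirdZ sD _ _ _ _ Dx) (third_sym12 oD sD u _ _ Dx) (thirdZ sD _ _ _ _ Dx).
  rewrite (third_sym23 oD sD v u _ Dx) (third_sym12 oD sD v _ u Dx) (thirdZ sD _ _ _ _ Dx).
  rewrite (third_sym23 oD sD v v u Dx) (third_sym12 oD sD v u v Dx).
  by move: (third _ _ _ _ _) => A; field; rewrite !gt_eqF.
have ab0 : 0 < a * b ^+ 2 by rewrite mulr_gt0 ?exprn_gt0.
rewrite e normrM (gtr0_norm (_ : 0 < (a * b ^+ 2)^-1)) ?invr_gt0 // mulrC ler_pdivrMr //.
Qed.

End ThirdDerivative.

(** * Integration of the third-derivative bound *)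

Section HessianComparisonScalars.
Context {R : realType}.
Implicit Types (a b h dh : R -> R) (K r s : R).

(** The spelling [1 + - r * s] is the instance of [a + b * s] that [is_derive_shiftV]
    differentiates. *)
Lemma one_sub_gt0 r s : 0 <= r -> r < 1 -> 0 <= s <= 1 -> 0 < 1 + - r * s.
Proof.
move=> r0 r1 /andP[s0 s1]; have : r * s <= r * 1 by rewrite ler_wpM2l.
by lra.
Qed.

Lemma one_subE r s : 1 + - r * s = 1 - s * r.
Proof. by rewrite mulNr mulrC. Qed.

Lemma is_derive_invX r s n : 1 + - r * s != 0 ->
  is_derive s 1 (fun s => (1 + - r * s)^-1 ^+ n.+1) (n.+1%:R * r * (1 + - r * s)^-1 ^+ n.+2).
Proof.
move=> h; have d1 := is_derive_shiftV h.
have d2 := is_deriveX (f := fun s => (1 + - r * s)^-1) n.+1 d1.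
rewrite (_ : (fun s => _) = (fun s => (1 + - r * s)^-1) ^+ n.+1); last first.
  by rewrite exprfctE.
apply: (is_derive_eq d2); rewrite /GRing.scale /= -mulr_natl -exprVn !exprS opprK.
by move: (_^-1) (n.+1%:R) (_ ^+ n) => A B C; ring.
Qed.

(** [h (1 - r s)^3] is nonincreasing and [h (1 - r s)^-3] nondecreasing in [s]. The 3 is the
    constant 5/2 of [third_le_mixed] rounded up to an integer exponent. *)
Lemma relative_growth_bound h dh r : 0 <= r -> r < 1 ->
  (forall s, 0 <= s <= 1 -> is_derive s 1 h (dh s)) ->
  (forall s, 0 <= s <= 1 -> `|dh s| * (1 + - r * s) <= 3 * r * h s) ->
  h 1 * (1 - r) ^+ 3 <= h 0 /\ h 0 * (1 - r) ^+ 3 <= h 1.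
Proof.
move=> r0 r1 dP hdh; have pos s := one_sub_gt0 (s := s) r0 r1.
have r10 : 0 < 1 - r by rewrite subr_gt0.
split.
  have dl s : is_derive s 1 (fun s => 1 + - r * s) (- r).
    by apply: is_derive_eq; rewrite /GRing.scale /=; ring.
  have dF s : 0 <= s <= 1 -> is_derive s 1 (fun s => - (h s * (1 + - r * s) ^+ 3))
      ((1 + - r * s) ^+ 2 * (3 * r * h s - dh s * (1 + - r * s))).
    move=> s01; have d1 := dP _ s01.
    have d2 := is_deriveX (f := fun s => 1 + - r * s) 3 (dl s).
    have d3 := is_deriveM d1 d2.
    have d4 : is_derive s 1 (- (h * (fun s => 1 + - r * s) ^+ 3)) _ := is_deriveN d3.
    apply: (is_derive_eq d4); rewrite /GRing.scale /= !fctE -mulr_natl.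
    by move: (h s) (dh s) => A B; ring.
  have dF0 s : 0 <= s <= 1 -> 0 <= (1 + - r * s) ^+ 2 * (3 * r * h s - dh s * (1 + - r * s)).
    move=> s01; rewrite mulr_ge0 ?sqr_ge0 // subr_ge0.
    apply: le_trans (hdh _ s01); rewrite ler_wpM2r ?ler_norm //.
    exact: ltW (pos _ s01).
  have := is_derive_ge0_le ler01 dF dF0.
  by rewrite mulr0 addr0 expr1n mulr1 lerN2 mulr1.
have dF s : 0 <= s <= 1 -> is_derive s 1 (fun s => h s * (1 + - r * s)^-1 ^+ 3)
    ((1 + - r * s)^-1 ^+ 4 * (3 * r * h s + dh s * (1 + - r * s))).
  move=> s01; have p0 := lt0r_neq0 (pos _ s01).
  have d3 := is_deriveM (dP _ s01) (is_derive_invX 2 p0).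
  apply: (is_derive_eq d3); rewrite /GRing.scale /=.
  by move: (h s) (dh s) p0 => A B p0; field.
have dF0 s : 0 <= s <= 1 -> 0 <= (1 + - r * s)^-1 ^+ 4 * (3 * r * h s + dh s * (1 + - r * s)).
  move=> s01; have ps := pos _ s01; rewrite mulr_ge0 ?exprn_ge0 ?invr_ge0 ?(ltW ps) //.
  rewrite -[dh s]opprK mulNr subr_ge0.
  apply: le_trans (hdh _ s01); rewrite ler_wpM2r ?(ltW ps) // -normrN ler_norm //.
have := is_derive_ge0_le ler01 dF dF0.
rewrite mulr0 addr0 invr1 expr1n !mulr1 => h01.
by rewrite -ler_pdivlMr ?exprn_gt0 // -exprVn.
Qed.

Lemma second_order_bound a b da K r : 0 <= r -> r < 1 ->
  (forall s, 0 <= s <= 1 -> is_derive s 1 a (da s)) ->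
  (forall s, 0 <= s <= 1 -> is_derive s 1 b (a s)) ->
  (forall s, 0 <= s <= 1 -> da s <= K * r ^+ 2 * (1 + - r * s)^-1 ^+ 4) ->
  b 1 - b 0 - a 0 <= K / 6 * ((1 - r)^-1 ^+ 2 - 1 - 2 * r).
Proof.
move=> r0 r1 aP bP daK; have pos s := one_sub_gt0 (s := s) r0 r1.
have a_le t : 0 <= t <= 1 -> a t <= a 0 + K * r / 3 * ((1 + - r * t)^-1 ^+ 3 - 1).
  move=> /andP[t0 t1].
  have in_ s : 0 <= s <= t -> 0 <= s <= 1.
    by move=> /andP[-> st]; exact: le_trans t1.
  have dF s : 0 <= s <= t -> is_derive s 1 (fun s => K * r / 3 * (1 + - r * s)^-1 ^+ 3)
      (K * r ^+ 2 * (1 + - r * s)^-1 ^+ 4).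
    move=> /in_ s01; have d := is_derive_invX 2 (lt0r_neq0 (pos _ s01)).
    have d2 : is_derive s 1 ((K * r / 3) *: (fun s => (1 + - r * s)^-1 ^+ 3)) _ :=
      is_deriveZ _ d.
    apply: (is_derive_eq d2); rewrite /GRing.scale /=.
    by move: ((1 + - r * s)^-1) => A; field.
  have := is_derive_le t0 (fun s s0t => aP s (in_ s s0t)) dF (fun s s0t => daK s (in_ s s0t)).
  rewrite mulr0 addr0 invr1 expr1n mulr1.
  by move: (a t) (a 0) (_ ^+ 3) => A B C; lra.
have dF s : 0 <= s <= 1 -> is_derive s 1
    (fun s => K / 6 * (1 + - r * s)^-1 ^+ 2 + (a 0 - K * r / 3) * s)
    (a 0 + K * r / 3 * ((1 + - r * s)^-1 ^+ 3 - 1)).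
  move=> s01; have d := is_derive_invX 1 (lt0r_neq0 (pos _ s01)).
  have d2 : is_derive s 1 ((K / 6) *: (fun s => (1 + - r * s)^-1 ^+ 2)) _ :=
      is_deriveZ _ d.
  have d3 := is_deriveD d2 (is_derive_mull (a 0 - K * r / 3) s).
  apply: (is_derive_eq d3); rewrite /GRing.scale /=.
  by move: ((1 + - r * s)^-1) (a 0) => A B; field.
have := is_derive_le ler01 bP dF a_le.
rewrite mulr0 addr0 invr1 expr1n !mulr1.
by move: (b 1) (b 0) (a 0) (_ ^+ 2) => A B C E; lra.
Qed.

Lemma mixed_bound (c E F G H : R) : 0 < c -> 0 <= E -> 0 <= F -> 0 <= G -> 0 <= H ->
  E * c ^+ 2 <= G -> F * c <= H ->
  5 / 2 * (E * F ^+ 2) <= 5 / 2 * G * H ^+ 2 * c^-1 ^+ 4.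
Proof.
move=> c0 E0 F0 G0 H0 h1 h2; rewrite exprVn ler_pdivlMr ?exprn_gt0 //.
have h3 : (F * c) ^+ 2 <= H ^+ 2 by rewrite lerXn2r ?nnegrE ?mulr_ge0 // ltW.
have := ler_pM (mulr_ge0 E0 (exprn_ge0 2 (ltW c0))) (sqr_ge0 _) h1 h3.
lra.
Qed.

Lemma norm_sub_le (A B C E : R) : A - B - C <= E -> - A - - B - - C <= E ->
  `|A - B - C| <= E.
Proof. by move=> h1 h2; rewrite ler_norml; apply/andP; split; lra. Qed.

(** The exponent 3/2 left by the square root is rounded up to 2. *)
Lemma sqrt_compare r (A B E F : R) : 0 <= r -> r < 1 -> 0 <= A -> 0 <= B ->
  A ^+ 2 = E -> B ^+ 2 = F -> F * (1 - r) ^+ 3 <= E -> B * (1 - r) ^+ 2 <= A.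
Proof.
move=> r0 r1 A0 B0 <- <- h; have r10 : 0 <= 1 - r by rewrite subr_ge0 ltW.
rewrite -ler_sqr ?nnegrE ?mulr_ge0 ?exprn_ge0 //; apply: le_trans h.
rewrite exprMn -exprM ler_wpM2l ?exprn_ge0 // (exprSr _ 3) ler_piMr ?exprn_ge0 //.
by rewrite gerBl.
Qed.

End HessianComparisonScalars.

Section HessianComparison.
Context {R : realType} {p : nat}.
Context (nu : R) (X D : set 'rV[R]_p) (f : 'rV[R]_p -> R).
Context (scb : self_concordant_barrier nu X D f).
Implicit Types (x y u v w : 'rV[R]_p) (s t r : R).

Let oD : open D := scb_open scb.
Let sD : continuously_differentiable 3 D f := scb_smooth scb.

Lemma dikin_segment x u s : D x -> lnorm f x u < 1 -> 0 <= s <= 1 -> D (x + s *: u).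
Proof.
move=> Dx u1 /andP[s0 s1]; apply: (dikin scb Dx).
rewrite lnormZ ger0_norm //; apply: le_lt_trans u1.
by rewrite ler_piMl ?lnorm_ge0.
Qed.

Lemma dikin_lnorm_le x u s : D x -> lnorm f x u < 1 -> 0 <= s <= 1 ->
  lnorm f (x + s *: u) u * (1 + - lnorm f x u * s) <= lnorm f x u.
Proof.
move=> Dx u1 /andP[s0 s1]; rewrite one_subE.
apply: (lnorm_segment_le scb s0) => q /andP[q0 qs].
by apply: dikin_segment => //; rewrite q0 (le_trans qs).
Qed.

Lemma hess_compare x u v : D x -> lnorm f x u < 1 ->
  dot (v *m hess f (x + u)) v * (1 - lnorm f x u) ^+ 3 <= dot (v *m hess f x) v /\
  dot (v *m hess f x) v * (1 - lnorm f x u) ^+ 3 <= dot (v *m hess f (x + u)) v.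
Proof.
move=> Dx u1; have u0 := lnorm_ge0 f x u.
have A s : 0 <= s <= 1 -> is_derive s 1 (fun s => dot (v *m hess f (x + s *: u)) v)
    (third f (x + s *: u) u v v).
  by move=> s01; exact: (is_derive_hess_line oD sD _ _ (dikin_segment Dx u1 s01)).
have := relative_growth_bound u0 u1 A.
rewrite scale0r addr0 scale1r; apply => s s01.
have Ds := dikin_segment Dx u1 s01.
have c0 := ltW (one_sub_gt0 u0 u1 s01).
apply: (le_trans (ler_wpM2r c0 (third_le_mixed scb u v Ds))).
rewrite (sqr_lnorm scb _ Ds).
have h0 := hess_ge0 scb v Ds.
have := ler_wpM2r h0 (dikin_lnorm_le Dx u1 s01).
have : 0 <= lnorm f x u * dot (v *m hess f (x + s *: u)) v by rewrite mulr_ge0.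
move: (1 + - lnorm f x u * s) (lnorm f (x + s *: u) u) (lnorm f x u) (dot _ _) => A1 B C E.
by lra.
Qed.

Lemma lnorm_compare x u v : D x -> lnorm f x u < 1 ->
  lnorm f (x + u) v * (1 - lnorm f x u) ^+ 2 <= lnorm f x v.
Proof.
move=> Dx u1; have u0 := lnorm_ge0 f x u.
have [h _] := hess_compare v Dx u1.
exact: (sqrt_compare u0 u1 (lnorm_ge0 _ _ _) (lnorm_ge0 _ _ _)
  (sqr_lnorm scb v Dx) (sqr_lnorm scb v (dikin scb Dx u1)) h).
Qed.

(** The third derivative in [u, u, w] is integrated twice. Of its factor [(1 - r s)^-4], two powers
    come from the growth of the norm of [w] and two from that of [u]; 5/12 is 5/2 divided by 6. *)
Lemma grad_compare x u v : D x -> lnorm f x u < 1 ->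
  `|dot (grad f (x + u)) v - dot (grad f x) v - dot (u *m hess f x) v|
    <= 5 / 12 * ((1 - lnorm f x u)^-1 ^+ 2 - 1 - 2 * lnorm f x u) * lnorm f x v.
Proof.
move=> Dx u1; have u0 := lnorm_ge0 f x u.
have one_side w : dot (grad f (x + u)) w - dot (grad f x) w - dot (u *m hess f x) w
    <= 5 / 12 * ((1 - lnorm f x u)^-1 ^+ 2 - 1 - 2 * lnorm f x u) * lnorm f x w.
  have A s : 0 <= s <= 1 -> is_derive s 1 (fun s => dot (u *m hess f (x + s *: u)) w)
      (third f (x + s *: u) u u w).
    by move=> s01; exact: (is_derive_hess_line oD sD _ _ (dikin_segment Dx u1 s01)).
  have B s : 0 <= s <= 1 -> is_derive s 1 (fun s => dot (grad f (x + s *: u)) w)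
      (dot (u *m hess f (x + s *: u)) w).
    by move=> s01; exact: (is_derive_grad_line oD sD _ (dikin_segment Dx u1 s01)).
  have C s : 0 <= s <= 1 -> third f (x + s *: u) u u w
      <= 5 / 2 * lnorm f x w * lnorm f x u ^+ 2 * (1 + - lnorm f x u * s)^-1 ^+ 4.
    move=> s01; have Ds := dikin_segment Dx u1 s01.
    rewrite (third_sym23 oD sD u u w Ds) (third_sym12 oD sD u w u Ds).
    apply: (le_trans (ler_norm _)); apply: (le_trans (third_le_mixed scb w u Ds)).
    have c0 := one_sub_gt0 u0 u1 s01.
    have h1 := dikin_lnorm_le Dx u1 s01.
    have su1 : lnorm f x (s *: u) < 1.
      case/andP: (s01) => s0 s1; rewrite lnormZ ger0_norm //; apply: le_lt_trans u1.
      by rewrite ler_piMl.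
    have := lnorm_compare w Dx su1.
    rewrite lnormZ ger0_norm; last by case/andP: s01.
    rewrite -one_subE.
    have n0 := lnorm_ge0 f (x + s *: u) w; have n1 := lnorm_ge0 f (x + s *: u) u.
    have n2 := lnorm_ge0 f x w.
    move=> h2; exact: (mixed_bound c0 n0 n1 n2 u0 h2 h1).
  have := second_order_bound u0 u1 A B C.
  rewrite scale1r scale0r addr0 => /le_trans; apply.
  by rewrite le_eqVlt; apply/orP; left; apply/eqP; move: (_^-1 ^+ 2) => q; field.
have h1 := one_side v; have := one_side (- v).
by rewrite !dotNr lnormN => h2; apply: norm_sub_le.
Qed.

End HessianComparison.

(** * One inexact Newton step *)

Section NewtonStepScalars.
Context {R : realType}.
Implicit Types (r : R).

(** Numerically, [(6/5)^3 < (4/3)^2]. *)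
Lemma sqrt_ratio_le r (A B E F : R) : 0 <= r -> r <= 1 / 6 -> 0 <= A -> 0 <= B ->
  A ^+ 2 = E -> B ^+ 2 = F -> F * (1 - r) ^+ 3 <= E -> B <= 4 / 3 * A.
Proof.
move=> r0 r1 A0 B0 <- <- h.
have c0 : (0 : R) <= 4 / 3 by lra.
rewrite -(ler_sqr (B0 : B \in Num.nneg) (mulr_ge0 c0 A0)) exprMn.
have h1 : (5 / 6) ^+ 3 <= (1 - r) ^+ 3.
  by apply: lerXn2r; rewrite ?nnegrE; lra.
have h2 : B ^+ 2 * (5 / 6) ^+ 3 <= A ^+ 2.
  by apply: le_trans h; rewrite ler_wpM2l ?sqr_ge0.
have := sqr_ge0 B; lra.
Qed.

Lemma newton_residual_le r : 0 <= r -> r <= 1 / 6 ->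
  5 / 12 * ((1 - r)^-1 ^+ 2 - 1 - 2 * r) <= 8 / 5 * r ^+ 2.
Proof.
move=> r0 r1; have r10 : 0 < 1 - r by lra.
have -> : (1 - r)^-1 ^+ 2 - 1 - 2 * r = r ^+ 2 * (3 - 2 * r) / (1 - r) ^+ 2.
  by field; rewrite gt_eqF.
rewrite mulrA ler_pdivrMr ?exprn_gt0 //.
(* This product is [8/5 (1 - r)^2 - 5/12 (3 - 2 r)]; the constant 8/5 is attained at [r = 1/6]. *)
have h : 0 <= (1 / 6 - r) * (21 / 10 - 8 / 5 * r).
  by apply: mulr_ge0; lra.
have := mulr_ge0 (sqr_ge0 r) h; lra.
Qed.

Lemma le_of_sqr_le_mul (a b x : R) : 0 <= x -> a * x ^+ 2 <= b * x -> 0 <= b -> a * x <= b.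
Proof.
move=> x0 h b0; have [->|xn0] := eqVneq x 0; first by rewrite mulr0.
have xp : 0 < x by rewrite lt_neqAle eq_sym xn0.
by rewrite -(ler_pM2r xp) -mulrA -expr2.
Qed.

Lemma monotonicity_gap (t sg P Q S rr A B E : R) : 0 < t -> 0 <= sg ->
  0 <= - ((1 - sg) * t) * (P + (Q + S)) - t * (rr - P - Q) ->
  P <= A -> Q <= B -> `|rr| <= E -> (1 - sg) * S <= sg * (A + B) + E.
Proof.
move=> t0 s0 h PA QB; rewrite ler_norml => /andP[rE _].
have : 0 <= t * (sg * (P + Q) - (1 - sg) * S - rr) by lra.
rewrite pmulr_rge0 // => h2.
have := ler_wpM2l s0 (lerD PA QB); lra.
Qed.

Lemma three_terms_le (e h h' qm dl c n n' : R) :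
  `|e| <= qm * n -> `|h| <= dl * n -> `|h'| <= (c * dl) * n' ->
  0 <= qm + dl -> n <= c * n' ->
  `|e - h + h'| <= (c * qm + 2 * c * dl) * n'.
Proof.
move=> he hh hh' q0 nn.
have h1 : (qm + dl) * n <= (qm + dl) * (c * n') by rewrite ler_wpM2l.
apply: (le_trans (ler_normD _ _)); apply: (le_trans (lerD (ler_normB _ _) (lexx _))).
lra.
Qed.

Lemma residual_shift (A B C E F G H : R) : 0 = A + (B - C) + (E + F) ->
  A + (G - C) + H = G - B - E - F + H.
Proof. lra. Qed.

End NewtonStepScalars.

Section NewtonStep.
Context {R : realType} {p : nat}.
Context (nu : R) (X D : set 'rV[R]_p) (f : 'rV[R]_p -> R).
Context (scb : self_concordant_barrier nu X D f).
Implicit Types (x y z u v w xi zeta : 'rV[R]_p) (s t r : R).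

Lemma lnorm_ratio x u v : D x -> lnorm f x u <= 1 / 6 ->
  lnorm f (x + u) v <= 4 / 3 * lnorm f x v /\
  lnorm f x v <= 4 / 3 * lnorm f (x + u) v.
Proof.
move=> Dx ur; have u1 : lnorm f x u < 1 by apply: le_lt_trans ur _; lra.
have [h1 h2] := hess_compare scb v Dx u1.
have e1 := sqr_lnorm scb v Dx; have e2 := sqr_lnorm scb v (dikin scb Dx u1).
have n1 := lnorm_ge0 f x v; have n2 := lnorm_ge0 f (x + u) v.
have n0 := lnorm_ge0 f x u; split.
  exact: (sqrt_ratio_le n0 ur n1 n2 e1 e2 h1).
exact: (sqrt_ratio_le n0 ur n2 n1 e2 e1 h2).
Qed.

(** The defect of the optimality condition of the subproblem at [x] for the point [z] with
    subgradient [xi]; it vanishes at the exact solution. *)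
Definition residual zeta t x z xi : 'rV[R]_p :=
  t^-1 *: xi + (grad f x - zeta) + (z - x) *m hess f x.

Lemma residual_dot zeta t x z xi v : dot (residual zeta t x z xi) v =
  t^-1 * dot xi v + (dot (grad f x) v - dot zeta v) + dot ((z - x) *m hess f x) v.
Proof. by rewrite /residual !dotDl dotZl dotNl. Qed.

(** Both subgradients are expressed through their residuals and inserted in the monotonicity
    inequality. The gradient, [zeta] and Hessian terms common to both cancel up to the factor
    [sg]. *)
Lemma newton_distance zeta t sg x z xi z' xi' (M E d : R) : D x -> 0 < t -> 0 <= sg -> sg < 1 ->
  0 <= M -> 0 <= E -> 0 <= d ->
  (forall v, `|dot zeta v| <= M * lnorm f x v) ->
  (forall v, `|dot (residual zeta t x z xi) v| <= E * lnorm f x v) ->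
  lnorm f x (z - x) <= d ->
  residual zeta ((1 - sg) * t) x z' xi' = 0 ->
  0 <= dot (xi' - xi) (z' - z) ->
  (1 - sg) * lnorm f x (z' - z) <= sg * (Num.sqrt nu + M + d) + E.
Proof.
move=> Dx t0 s0 s1 M0 E0 d0 zM rE zd r0 mono.
set w := z' - z in mono *.
have s10 : 0 < 1 - sg by rewrite subr_gt0.
have t'0 : 0 < (1 - sg) * t by rewrite mulr_gt0.
have e1 : dot xi w = t * (dot (residual zeta t x z xi) w
    - (dot (grad f x) w - dot zeta w) - dot ((z - x) *m hess f x) w).
  rewrite residual_dot; move: (dot _ _) (dot _ _) (dot _ _) (dot _ _) => a b c e.
  by field; rewrite gt_eqF.
have e2 : dot xi' w = - ((1 - sg) * t) * (dot (grad f x) w - dot zeta w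
    + (dot ((z - x) *m hess f x) w + dot (w *m hess f x) w)).
  have := residual_dot zeta ((1 - sg) * t) x z' xi' w.
  rewrite r0 dotC dot0r (_ : z' - x = z - x + w); last by rewrite [RHS]addrC /w addrA subrK.
  rewrite mulmxDl dotDl => /eqP; rewrite eq_sym -addrA addrC addr_eq0 => /eqP h.
  by rewrite h mulrNN mulrA divff ?mul1r // gt_eqF.
apply: le_of_sqr_le_mul (lnorm_ge0 _ _ _) _ _; last first.
  by rewrite addr_ge0 // mulr_ge0 // !addr_ge0 // sqrtr_ge0.
rewrite (sqr_lnorm scb _ Dx).
rewrite dotBl e1 e2 in mono.
have h1 : dot (grad f x) w - dot zeta w <= (Num.sqrt nu + M) * lnorm f x w.
  apply: (le_trans (ler_norm _)); apply: (le_trans (ler_normB _ _)).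
  by rewrite mulrDl; apply: lerD; [exact: (grad_le scb)|exact: zM].
have h2 : dot ((z - x) *m hess f x) w <= d * lnorm f x w.
  apply: (le_trans (ler_norm _)); apply: (le_trans (hess_cs scb _ _ Dx)).
  by rewrite ler_wpM2r ?lnorm_ge0.
have := monotonicity_gap t0 s0 mono h1 h2 (rE w).
by move=> /le_trans; apply; rewrite -mulrDl mulrA -mulrDl.
Qed.

(** As the residual at [x] is zero, the one at [x'] consists of the linearization error of the
    gradient over [x' - x] and of the two Hessians applied to [z' - x']. *)
Lemma newton_residual zeta t x x' z' xi' (dl mu : R) : D x ->
  lnorm f x (x' - x) <= mu -> mu <= 1 / 6 ->
  lnorm f x (z' - x') <= dl -> residual zeta t x z' xi' = 0 ->
  [/\ D x', lnorm f x' (z' - x') <= 4 / 3 * dl &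
   forall v, `|dot (residual zeta t x' z' xi') v|
     <= (4 / 3 * (8 / 5 * mu ^+ 2) + 2 * (4 / 3) * dl) * lnorm f x' v].
Proof.
move=> Dx xmu mu1 zdl r0.
have x1 : lnorm f x (x' - x) <= 1 / 6 := le_trans xmu mu1.
have xlt1 : lnorm f x (x' - x) < 1 by apply: le_lt_trans x1 _; lra.
have Dx' : D x' by have := dikin scb Dx xlt1; rewrite addrC subrK.
have xx' : x + (x' - x) = x' by rewrite addrC subrK.
have rat v := lnorm_ratio v Dx x1; rewrite xx' in rat.
have dl0 : 0 <= dl := le_trans (lnorm_ge0 _ _ _) zdl.
have z'd : lnorm f x' (z' - x') <= 4 / 3 * dl.
  apply: (le_trans (rat _).1); rewrite ler_wpM2l //; lra.
split => // v.
have -> : dot (residual zeta t x' z' xi') v =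
    (dot (grad f x') v - dot (grad f x) v - dot ((x' - x) *m hess f x) v)
    - dot ((z' - x') *m hess f x) v + dot ((z' - x') *m hess f x') v.
  have := residual_dot zeta t x z' xi' v; rewrite r0 dotC dot0r residual_dot.
  rewrite (_ : z' - x = (x' - x) + (z' - x')); last by rewrite [RHS]addrC addrA subrK.
  rewrite mulmxDl dotDl.
  by move=> h; exact: (residual_shift _ _ h).
have m0 : 0 <= lnorm f x (x' - x) := lnorm_ge0 _ _ _.
have m0' : 0 <= mu := le_trans m0 xmu.
have h1 : `|dot (grad f x') v - dot (grad f x) v - dot ((x' - x) *m hess f x) v|
    <= 8 / 5 * mu ^+ 2 * lnorm f x v.
  have := grad_compare scb v Dx xlt1; rewrite xx' => /le_trans; apply.
  rewrite ler_wpM2r ?lnorm_ge0 //; apply: (le_trans (newton_residual_le m0 x1)).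
  by rewrite ler_wpM2l ?lerXn2r ?nnegrE //; lra.
have h2 : `|dot ((z' - x') *m hess f x) v| <= dl * lnorm f x v.
  apply: (le_trans (hess_cs scb _ _ Dx)); by rewrite ler_wpM2r ?lnorm_ge0.
have h3 : `|dot ((z' - x') *m hess f x') v| <= 4 / 3 * dl * lnorm f x' v.
  apply: (le_trans (hess_cs scb _ _ Dx')); by rewrite ler_wpM2r ?lnorm_ge0.
apply: (three_terms_le h1 h2 h3 _ (rat v).2).
by rewrite addr_ge0 // mulr_ge0 ?sqr_ge0 //; lra.
Qed.

End NewtonStep.

(** * Subgradients of the objective *)

Section Subgradients.
Context {R : realType} {p : nat}.
Context (c : 'rV[R]_p) (g : 'rV[R]_p -> \bar R).
Context (pg : proper g) (cg : convex_set (epigraph g)).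
Implicit Types (x y z xi zeta w : 'rV[R]_p).

(** The finite value is part of the definition, so two subgradient inequalities can be added as
    inequalities of reals. *)
Definition objective_subgradient z xi : Prop :=
  exists2 r : R, objective c g z = r%:E &
    forall y, ((r + dot xi (y - z))%:E <= objective c g y)%E.

Lemma objective_NyN y : objective c g y != -oo%E.
Proof. by rewrite /objective; case: (g y) (pg.1 y). Qed.

Lemma objective_fin y : (g y < +oo)%E ->
  exists2 r : R, objective c g y = r%:E & g y = (r - dot c y)%:E.
Proof.
rewrite /objective; case: (g y) (pg.1 y) => // r _ _.
by exists (dot c y + r); rewrite // addrC addKr.
Qed.

Lemma subdifferential_objective x xi : subdifferential g x xi ->
  objective_subgradient x (c + xi).
Proof.
move=> [/objective_fin [r er eg] h]; exists r => // y.
have := h y; rewrite eg /objective; case: (g y) (pg.1 y) => [s| |] // _; last first.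
  by move=> _; rewrite addey // leey.
rewrite !lee_fin dotDl dotBr => hs; apply: le_trans (lerD (lexx (dot c y)) hs).
by rewrite le_eqVlt; apply/orP; left; apply/eqP; ring.
Qed.

Lemma objective_subgradient_monotone z xi z' xi' :
  objective_subgradient z xi -> objective_subgradient z' xi' ->
  0 <= dot (xi' - xi) (z' - z).
Proof.
move=> [r er h] [r' er' h'].
have := h z'; have := h' z; rewrite er er' !lee_fin.
rewrite dotBl -(opprB z' z) dotNr.
by move: (dot _ _) (dot _ _) => a b; lra.
Qed.

Lemma objective_EFin y (r : R) : objective c g y = r%:E -> g y = (r - dot c y)%:E.
Proof.
rewrite /objective; case: (g y) => //= a [<-].
by rewrite addrAC subrr add0r.
Qed.

Lemma objective_convex y z (r s t : R) : objective c g y = r%:E -> objective c g z = s%:E ->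
  0 <= t <= 1 -> (objective c g (z + t *: (y - z)) <= (s + t * (r - s))%:E)%E.
Proof.
move=> ey ez /andP[t0 t1].
have gy := objective_EFin ey; have gz := objective_EFin ez.
have := cg (x := (y, r - dot c y)) (y := (z, s - dot c z)) (Itv01 t0 t1).
rewrite !inE /epigraph /= gy gz => /(_ (lexx _) (lexx _)).
rewrite /unstable.onem (_ : t *: y + (1 - t) *: z = z + t *: (y - z)); last first.
  by rewrite scalerBl scale1r scalerBr addrCA.
rewrite /objective => h; apply: (le_trans (leeD (lexx _) h)).
rewrite lee_fin dotDr dotZr dotBr /GRing.scale /=.
by rewrite le_eqVlt; apply/orP; left; apply/eqP; ring.
Qed.

Context (nu : R) (X D : set 'rV[R]_p) (f : 'rV[R]_p -> R).
Context (scb : self_concordant_barrier nu X D f).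

Definition model zeta x y : R :=
  dot (grad f x - zeta) (y - x) + 2^-1 * dot ((y - x) *m hess f x) (y - x).

Lemma subproblemE zeta t x y :
  subproblem f c g 1 zeta t x y = ((model zeta x y)%:E + (t^-1)%:E * objective c g y)%E.
Proof. by rewrite /subproblem scale1r. Qed.

Lemma modelD zeta x y w : D x -> model zeta x (y + w) = model zeta x y
  + dot (grad f x - zeta + (y - x) *m hess f x) w + 2^-1 * dot (w *m hess f x) w.
Proof.
move=> Dx; rewrite /model (addrAC y w).
move: (y - x) (grad f x - zeta) => v a; rewrite mulmxDl !dotDl !dotDr.
rewrite (dot_hess_sym (scb_open scb) (scb_smooth scb) w v Dx).
by move: (dot a v) (dot a w) (dot _ v) (dot _ w) (dot _ w) => *; field.
Qed.

(** Fermat's rule by hand: [xi] is [- t] times the gradient of the quadratic model at [z]. Comparing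
    [z] with points of the segment towards [y] leaves a quadratic error, which [first_order_ge0]
    removes. *)
Lemma subproblem_subgradient zeta t x z : D x -> 0 < t -> edom g !=set0 ->
  minimizer_on setT (subproblem f c g 1 zeta t x) z ->
  exists2 xi, objective_subgradient z xi & residual f zeta t x z xi = 0.
Proof.
move=> Dx t0 [y0 gy0] [_ zmin].
have [r0 er0 _] := objective_fin gy0.
have ti0 : 0 < t^-1 by rewrite invr_gt0.
have gz : (g z < +oo)%E.
  (* Comparison with a point of finite value shows that [g] is finite at the minimizer. *)
  have := zmin y0 I; rewrite !subproblemE er0.
  rewrite /objective; case: (g z) => [q _|h|_] //; first by rewrite ltry.
  by move: h; rewrite addey // gt0_muley ?lte_fin // addey.
have [rz ez _] := objective_fin gz.
pose b := grad f x - zeta + (z - x) *m hess f x.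
exists (- t *: b); last first.
  rewrite /residual scalerA mulrN mulVf ?gt_eqF // scaleN1r /b.
  by rewrite -addrA addrC subrr.
exists rz => // y.
case ey : (objective c g y) => [r| |]; last by have := objective_NyN y; rewrite ey.
  rewrite lee_fin dotZl.
  suff : 0 <= dot b (y - z) + t^-1 * (r - rz).
    rewrite -(pmulr_rge0 _ t0) mulrDr mulrA divff ?gt_eqF // mul1r.
    by move: (dot _ _) => a; lra.
  apply: (@first_order_ge0 _ _ (2^-1 * dot ((y - z) *m hess f x) (y - z))) => s s0 s1.
  have s01 : 0 <= s <= 1 by rewrite (ltW s0).
  have := zmin (z + s *: (y - z)) I; rewrite !subproblemE ez modelD // => h.
  have := le_trans h (leeD (lexx _) (lee_wpmul2l _ (objective_convex ey ez s01))).
  rewrite lee_fin (ltW ti0) => /(_ isT).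
  rewrite -!EFinM -!EFinD lee_fin -/b dotZr -scalemxAl dotZl dotZr.
  by move: (dot _ _) (dot _ _) (model _ _ _) (t^-1) => A B C E; lra.
by rewrite leey.
Qed.

Lemma subproblem_value_le zeta t x z z' (r e : R) : 0 < t -> objective c g z = r%:E ->
  (subproblem f c g 1 zeta t x z' <= subproblem f c g 1 zeta t x z + e%:E)%E ->
  exists2 r' : R, objective c g z' = r'%:E &
    r' - r <= t * (e + model zeta x z - model zeta x z').
Proof.
move=> t0 ez; rewrite !subproblemE ez.
have ti0 : 0 < t^-1 by rewrite invr_gt0.
case ez' : (objective c g z') => [r'| |]; last by have := objective_NyN z'; rewrite ez'.
  rewrite -!EFinM -!EFinD lee_fin => h; exists r' => //.
  have : t^-1 * (r' - r) <= e + model zeta x z - model zeta x z'.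
    by move: h; move: (model _ _ _) (model _ _ _) => A B; lra.
  by rewrite mulrC ler_pdivrMr // mulrC.
by rewrite gt0_muley ?lte_fin // addey.
Qed.

End Subgradients.

(** * Constants of the algorithm *)

Section Constants.
Context {R : realType}.
Context (beta : R) (beta0 : 0 < beta) (beta1 : beta <= 1 / 9).
Implicit Types (m nu F : R).

Let s : R := Num.sqrt beta.

Let s0 : 0 < s. Proof. by rewrite sqrtr_gt0. Qed.

Let ss : beta = s ^+ 2. Proof. by rewrite sqr_sqrtr // ltW. Qed.

Let s1 : s <= 1 / 3.
Proof.
have t0 : (0 : R) <= 1 / 3 by lra.
rewrite -(ler_sqr (ltW s0 : s \in Num.nneg) (t0 : _ \in Num.nneg)) -ss; move: beta1; lra.
Qed.

Let beta_facts : [/\ 0 < beta, beta <= 1 / 9, 0 < s, s <= 1 / 3 & beta = s ^+ 2].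
Proof. by split. Qed.

Lemma beta_le_r_beta : beta <= r_beta beta.
Proof.
have [hb0 hb1 hs0 hs1 hss] := beta_facts.
have : 0 <= s * (1 / 3 - s) by apply: mulr_ge0; lra.
rewrite /r_beta -/s; lra.
Qed.

Lemma beta_lt_r_beta : beta < r_beta beta.
Proof.
have [hb0 hb1 hs0 hs1 hss] := beta_facts.
have : 0 <= s * (1 / 3 - s) by apply: mulr_ge0; lra.
rewrite /r_beta -/s; lra.
Qed.

Lemma r_beta_le : r_beta beta <= 43 / 300.
Proof.
have [hb0 hb1 hs0 hs1 hss] := beta_facts.
rewrite /r_beta -/s; lra. Qed.

(** [(1 + r)^2] exceeds the radicand by [4 (r - beta)], where [r] is [r_beta beta]. *)
Lemma c_beta_gt0 : 0 < c_beta beta.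
Proof.
have [hb0 hb1 hs0 hs1 hss] := beta_facts.
rewrite /c_beta; apply: divr_gt0; last by lra.
have h := beta_lt_r_beta; have h2 := r_beta_le.
rewrite subr_gt0 -[ltRHS]ger0_norm; last by lra.
rewrite -sqrtr_sqr ltr_sqrt; last by apply: exprn_gt0; lra.
lra.
Qed.

(** Since [beta <= r], the square of [1 - r + 2 beta] is at most the radicand. *)
Lemma c_beta_le : c_beta beta <= r_beta beta - beta.
Proof.
have [hb0 hb1 hs0 hs1 hss] := beta_facts.
have h := beta_le_r_beta; have h2 := r_beta_le.
rewrite /c_beta ler_pdivrMr; last by lra.
suff : 1 - r_beta beta + 2 * beta <= Num.sqrt ((1 - r_beta beta) ^+ 2 + 4 * beta) by lra.
rewrite -[leLHS]ger0_norm; last by lra.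
rewrite -sqrtr_sqr; apply: ler_wsqrtr.
have : 0 <= beta * (r_beta beta - beta) by apply: mulr_ge0; lra.
lra.
Qed.

Lemma sigma_beta_bounds nu : 1 <= nu -> 0 < sigma_beta beta nu /\ sigma_beta beta nu < 1 /\
  sigma_beta beta nu * Num.sqrt nu = c_beta beta / (1 + c_beta beta).
Proof.
have [hb0 hb1 hs0 hs1 hss] := beta_facts.
move=> nu1; have c0 := c_beta_gt0.
have q1 : 1 <= Num.sqrt nu by rewrite -[leLHS]sqrtr1; apply: ler_wsqrtr.
have q0 : 0 < Num.sqrt nu by apply: lt_le_trans q1.
have c1 : 0 < 1 + c_beta beta by rewrite addr_gt0.
rewrite /sigma_beta; split; first by apply: divr_gt0 => //; exact: mulr_gt0.
split.
  rewrite ltr_pdivrMr; last exact: mulr_gt0.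
  rewrite mul1r; apply: lt_le_trans (ler_wpM2l (ltW c1) q1).
  by rewrite mulr1 ltrDr.
by field; rewrite !gt_eqF.
Qed.

(** [mu] adds the distance [Dd] between consecutive exact solutions, the distance [9/100 beta] of
    the current iterate from its own exact solution, and the inexactness [delta]. The conclusion
    says that the constant [9/10] reproduces itself. *)
Lemma step_bound nu (M Dd : R) : 1 <= nu -> 0 <= M -> M <= 173 / 500 -> 0 <= Dd ->
  (1 - sigma_beta beta nu) * Dd <= sigma_beta beta nu * (Num.sqrt nu + M + 9 / 100 * beta)
    + 9 / 10 * beta ->
  let mu := Dd + 9 / 100 * beta + delta beta in
  mu <= 1 / 6 /\
  4 / 3 * (8 / 5 * mu ^+ 2) + 2 * (4 / 3) * delta beta <= 9 / 10 * beta.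
Proof.
have [hb0 hb1 hs0 hs1 hss] := beta_facts.
move=> nu1 M0 M1 D0 h mu.
have [sg0 [sg1 sgq]] := sigma_beta_bounds nu1.
have q1 : 1 <= Num.sqrt nu by rewrite -[leLHS]sqrtr1; apply: ler_wsqrtr.
have c0 := c_beta_gt0; have cle := c_beta_le.
have rE : r_beta beta = 43 / 100 * s by [].
rewrite rE in cle.
move: (c_beta beta) (sigma_beta beta nu) (Num.sqrt nu) c0 cle sg0 sg1 sgq q1 h.
move=> c sg q c0 cle sg0 sg1 sgq q1 h.
have c1 : 0 < 1 + c by rewrite addr_gt0.
(* [k] is [sg * q], and [1 / (1 - k) = 1 + c] turns the division by [1 - sg] into a
   multiplication. *)
pose k := c / (1 + c).
have k1 : (1 - k) * (1 + c) = 1 by rewrite /k; field; rewrite gt_eqF.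
have kc : k * (1 + c) = c by rewrite /k; field; rewrite gt_eqF.
have k0 : 0 < k by rewrite divr_gt0.
have sgk : sg <= k.
  by rewrite /k -sgq -[leLHS]mulr1 ler_pM2l.
have sgq' : sg * q = k by [].
clearbody k.
have e1 : (1 - k) * Dd <= (1 - sg) * Dd by apply: ler_wpM2r => //; lra.
have e2 : sg * (M + 9 / 100 * beta) <= k * (89 / 250).
  by apply: ler_pM => //; lra.
have e3 : (1 - k) * Dd <= k * (339 / 250) + 9 / 10 * beta by lra.
have e4 : Dd <= c * (339 / 250) + (1 + c) * (9 / 10 * beta).
  have := ler_wpM2r (ltW c1) e3.
  rewrite mulrAC k1 mul1r mulrDl mulrAC kc; lra.
have e5 : c <= 1 / 20.
  have := sqr_ge0 (s - 1 / 5); lra.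
have e6 : c * (9 / 10 * beta) <= 1 / 20 * (9 / 10 * beta).
  by apply: ler_wpM2r => //; lra.
have muE : mu = Dd + 9 / 100 * beta + beta / 16 by [].
(* Everything is now bounded in [s = sqrt beta]; this bound equals 1/6 at the largest value
   [s = 1/3]. *)
have e7 : mu <= 7 / 12 * s - 1 / 4 * s ^+ 2.
  rewrite muE; lra.
have e8 : mu <= 1 / 6.
  have : 0 <= (1 / 3 - s) * (1 / 2 - 1 / 4 * s) by apply: mulr_ge0; lra.
  lra.
split=> //.
have mu0 : 0 <= mu by rewrite muE; lra.
have e9 : mu <= 7 / 12 * s by have := sqr_ge0 s; lra.
have : mu ^+ 2 <= (7 / 12 * s) ^+ 2 by apply: lerXn2r; rewrite ?nnegrE //; lra.
rewrite exprMn -ss /delta; lra.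
Qed.

Section Psi.
Context (m : R) (m0 : 0 <= m) (m1 : m < (1 - beta) / (3 + beta)).

Lemma m_lt_third : m < 1 / 3.
Proof.
have [hb0 hb1 _ _ _] := beta_facts.
apply: (lt_le_trans m1); rewrite ler_pdivrMr; last by lra.
lra.
Qed.

Let m3 := m_lt_third.

Let ratio1 : 1 <= (1 - m) / (1 - 2 * m).
Proof.
have [hb0 hb1 hs0 hs1 hss] := beta_facts; have hm0 := m0; have hm3 := m3.
by rewrite ler_pdivlMr; lra. Qed.

Let ratio2 : (1 - m) / (1 - 2 * m) <= 2.
Proof.
have [hb0 hb1 hs0 hs1 hss] := beta_facts; have hm0 := m0; have hm3 := m3.
by rewrite ler_pdivrMr; lra. Qed.

Let frac1 : m + m ^+ 2 <= m / (1 - m).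
Proof.
have [hb0 hb1 hs0 hs1 hss] := beta_facts; have hm0 := m0; have hm3 := m3.
rewrite ler_pdivlMr; last by lra.
have := mulr_ge0 m0 (sqr_ge0 m); lra.
Qed.

Let frac2 : m / (1 - m) <= 1 / 2.
Proof.
have [hb0 hb1 hs0 hs1 hss] := beta_facts; have hm0 := m0; have hm3 := m3.
by rewrite ler_pdivrMr; lra. Qed.

Let gamma1_ge : m + m ^+ 2 + beta <= gamma_1 beta m.
Proof.
have [hb0 hb1 hs0 hs1 hss] := beta_facts; have hm0 := m0; have hm3 := m3.
rewrite /gamma_1 (mulrC (1 - m)) -mulrA.
have := ler_wpM2l (ltW beta0) ratio1; have := frac1; lra.
Qed.

Let gammah_ge : m + m ^+ 2 + beta <= gamma_hat beta m.
Proof.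
have [hb0 hb1 hs0 hs1 hss] := beta_facts; have hm0 := m0; have hm3 := m3.
rewrite /gamma_hat -mulrA.
have r0 : 0 <= r_beta beta by apply: le_trans beta_le_r_beta; exact: ltW.
have := ler_wpM2l r0 ratio1; have := frac1; have := beta_le_r_beta; lra.
Qed.

Let gamma1_le : gamma_1 beta m <= 1.
Proof.
have [hb0 hb1 hs0 hs1 hss] := beta_facts; have hm0 := m0; have hm3 := m3.
rewrite /gamma_1 (mulrC (1 - m)) -mulrA.
have := ler_wpM2l (ltW beta0) ratio2; have := frac2; lra.
Qed.

Let gammah_le : gamma_hat beta m <= 4 / 5.
Proof.
have [hb0 hb1 hs0 hs1 hss] := beta_facts; have hm0 := m0; have hm3 := m3.
rewrite /gamma_hat -mulrA.
have r0 : 0 <= r_beta beta by apply: le_trans beta_le_r_beta; exact: ltW.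
have := ler_wpM2l r0 ratio2; have := frac2; have := r_beta_le; lra.
Qed.

(** Both [gamma_1] and [gamma_hat] dominate [m + m^2 + beta], hence [F], and [gamma_hat <= 4/5]. The
    remaining terms of [psi_beta] are nonnegative. *)
Lemma psi_beta_ge nu F : 1 <= nu -> 0 <= F -> F <= m + m ^+ 2 + beta ->
  F < 1 /\ nu + Num.sqrt nu * (F / (1 - F)) + delta beta ^+ 2 / 2 <= psi_beta beta m nu.
Proof.
have [hb0 hb1 hs0 hs1 hss] := beta_facts; have hm0 := m0; have hm3 := m3.
move=> nu1 F0 Fle; rewrite /psi_beta.
have h1 := gamma1_ge; have h2 := gammah_ge; have h3 := gammah_le.
have g0 : 0 <= gamma_1 beta m by lra.
have gh0 : 0 <= gamma_hat beta m by lra.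
have Fgh : F <= gamma_hat beta m by lra.
have Fg1 : F <= gamma_1 beta m by lra.
move: (gamma_1 beta m) (gamma_hat beta m) h3 g0 gh0 Fgh Fg1 => g gh h3 g0 gh0 Fgh Fg1.
have d0 : 0 <= delta beta by rewrite /delta; lra.
have q0 : 0 <= Num.sqrt nu by exact: sqrtr_ge0.
split; first by lra.
have ghp : 0 < 1 - gh by lra.
have Fp : 0 < 1 - F by lra.
have e1 : F / (1 - F) <= g / (1 - gh).
  by apply: ler_pM => //; [rewrite invr_ge0 ltW|rewrite lef_pV2 ?posrE //; lra].
have e2 := ler_wpM2l q0 e1.
have e3 : 0 <= gh / (1 - gh) ^+ 2 * (gh + g + delta beta).
  by apply: mulr_ge0; [apply: divr_ge0 => //; exact: sqr_ge0|lra].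
have e4 := mulr_ge0 m0 g0.
lra.
Qed.

(** A crude count from [gamma_1 <= 1], [gamma_hat <= 4/5] and [sqrt nu <= nu]. *)
Lemma psi_beta_le nu : 1 <= nu -> psi_beta beta m nu <= 100 * nu.
Proof.
have [hb0 hb1 hs0 hs1 hss] := beta_facts; have hm0 := m0; have hm3 := m3.
move=> nu1; rewrite /psi_beta.
have h1 := gamma1_ge; have h2 := gammah_ge; have h3 := gammah_le; have h4 := gamma1_le.
have m20 := sqr_ge0 m.
have g0 : 0 <= gamma_1 beta m by lra.
have gh0 : 0 <= gamma_hat beta m by lra.
move: (gamma_1 beta m) (gamma_hat beta m) h3 h4 g0 gh0 => g gh h3 h4 g0 gh0.
have d0 : 0 <= delta beta by rewrite /delta; lra.
have d1 : delta beta <= 1 by rewrite /delta; lra.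
have q0 : 0 <= Num.sqrt nu by exact: sqrtr_ge0.
have q1 : 1 <= Num.sqrt nu by rewrite -[leLHS]sqrtr1; apply: ler_wsqrtr.
have qnu : Num.sqrt nu <= nu.
  rewrite -[leRHS](sqr_sqrtr (_ : 0 <= nu)); last by lra.
  by rewrite expr2 ler_peMl.
have ghp : 0 < 1 - gh by lra.
have i5 : (1 - gh)^-1 <= 5.
  by rewrite -[leRHS]invrK lef_pV2 ?posrE ?invr_gt0 //; lra.
have i0 : 0 <= (1 - gh)^-1 by rewrite invr_ge0 ltW.
have e1 : g / (1 - gh) <= 1 * 5 by apply: ler_pM.
have e2 := ler_wpM2l q0 e1.
have e3 : (1 - gh) ^- 2 <= 5 ^+ 2 by rewrite -exprVn; apply: lerXn2r; rewrite ?nnegrE.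
have e4 : gh / (1 - gh) ^+ 2 <= 4 / 5 * 5 ^+ 2.
  by apply: ler_pM => //; rewrite invr_ge0 sqr_ge0.
have e5 : gh / (1 - gh) ^+ 2 * (gh + g + delta beta) <= 4 / 5 * 5 ^+ 2 * (4 / 5 + 1 + 1).
  apply: ler_pM => //; [|lra|lra].
  by apply: divr_ge0 => //; exact: sqr_ge0.
have e6 : m * g <= 1 * 1 by apply: ler_pM => //; have := m3; lra.
have e7 : delta beta ^+ 2 <= 1 ^+ 2 by apply: lerXn2r; rewrite ?nnegrE.
lra.
Qed.

End Psi.

End Constants.

(** * Bounds from the starting point *)

Section CentralPointScalars.
Context {R : realType}.

Lemma kappa_max_le (beta nn : R) : kappa_max beta nn <= 1 / 2.
Proof.
rewrite /kappa_max; set a := a_0 beta nn.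
have : 2 * a <= Num.sqrt (4 * a ^+ 2 + 1).
  apply: (le_trans (ler_norm _)); rewrite -sqrtr_sqr; apply: ler_wsqrtr.
  by rewrite exprMn; lra.
by lra.
Qed.

(** [q] bounds the dual norm of [zeta0] at the start and the other factor is the radius of [D]
    there. As [1 - 2 kappa <= (1 - kappa)^2], the product is at most [m + m kappa / nn], and
    [3 kappa <= m]. *)
Lemma center_radius_le (nn kappa q m : R) : 3 <= nn -> 0 < kappa -> kappa < 1 / 2 -> kappa <= q ->
  m = nn * ((1 - kappa) * q) / (1 - 2 * kappa) ->
  q * ((nn + kappa) / (1 - kappa)) <= m + m ^+ 2 / 9.
Proof.
move=> n3 k0 k1 kq mE.
have n0 : 0 < nn by lra.
have k2 : 0 < 1 - 2 * kappa by lra.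
have k3 : 0 < 1 - kappa by lra.
have q0 : 0 < q by apply: lt_le_trans kq.
have nq : nn * q <= m.
  rewrite mE ler_pdivlMr // -mulrA; apply: ler_wpM2l; first exact: ltW.
  by rewrite mulrC; apply: ler_wpM2r; lra.
have m0 : 0 < m by apply: lt_le_trans nq; exact: mulr_gt0.
have -> : q = m * (1 - 2 * kappa) / (nn * (1 - kappa)).
  by rewrite mE; field; rewrite !gt_eqF.
have h1 : (1 - 2 * kappa) <= (1 - kappa) ^+ 2 by have := sqr_ge0 kappa; lra.
have h2 : m * (1 - 2 * kappa) / (nn * (1 - kappa)) * ((nn + kappa) / (1 - kappa))
   <= m * ((nn + kappa) / nn).
  have -> : m * (1 - 2 * kappa) / (nn * (1 - kappa)) * ((nn + kappa) / (1 - kappa))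
    = m * ((nn + kappa) / nn) * ((1 - 2 * kappa) / (1 - kappa) ^+ 2).
    by field; rewrite !gt_eqF.
  apply: ler_piMr; first by apply: mulr_ge0; [exact: ltW|apply: divr_ge0; lra].
  by rewrite ler_pdivrMr ?exprn_gt0 // mul1r.
apply: (le_trans h2).
have -> : m * ((nn + kappa) / nn) = m + m * (kappa / nn) by field; rewrite gt_eqF.
rewrite lerD2l expr2 -mulrA; apply: ler_wpM2l; first exact: ltW.
rewrite ler_pdivrMr //.
have h3 : 3 * kappa <= m by apply: le_trans nq; apply: ler_pM; lra.
have h4 : m / 9 * 3 <= m / 9 * nn by apply: ler_wpM2l => //; lra.
lra.
Qed.

End CentralPointScalars.

Section CentralPoint.
Context {R : realType} {p : nat}.
Context (nu : R) (X D : set 'rV[R]_p) (f : 'rV[R]_p -> R).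
Context (scb : self_concordant_barrier nu X D f).
Implicit Types (x y z u v w xi zeta : 'rV[R]_p) (s t r : R).

Lemma positive_definite_unitmx (A : 'M[R]_p) : positive_definite A -> A \in unitmx.
Proof.
move=> pd; rewrite -row_free_unit -kermx_eq0; apply/eqP/row_matrixP => i.
rewrite row0; apply/eqP/negPn/negP => u0.
have := pd _ u0; rewrite (_ : row i (kermx A) *m A = 0).
  by rewrite dotC dot0r ltxx.
by rewrite -row_mul mulmx_ker row0.
Qed.

(** Cauchy-Schwarz in the Hessian form, applied to [w] times the inverse Hessian. *)
Lemma dual_lnorm_cs x w v : D x -> positive_definite (hess f x) ->
  `|dot w v| <= dual_lnorm f x w * lnorm f x v.
Proof.
move=> Dx /positive_definite_unitmx uH.
have := hess_cs scb (w *m invmx (hess f x)) v Dx.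
rewrite mulmxKV // => /le_trans; apply.
rewrite /lnorm /dual_lnorm mulmxKV // dotC.
exact: lexx.
Qed.

(** [D] is bounded in the local norm at [x], so a long enough step in a coordinate direction leaves
    it, and [nu_ge1] applies. *)
Lemma nu_ge1_of_positive_definite x (kappa : R) : (0 < p)%N -> D x ->
  positive_definite (hess f x) -> 0 <= kappa -> kappa < 1 ->
  (forall v, `|dot (grad f x) v| <= kappa * lnorm f x v) -> 1 <= nu.
Proof.
move=> p0 Dx pd k0 k1 gk.
pose i : 'I_p := Ordinal p0.
pose e : 'rV[R]_p := delta_mx 0 i.
have e0 : e != 0.
  apply/eqP => /matrixP /(_ 0 i); rewrite !mxE !eqxx /= => /eqP.
  by rewrite oner_eq0.
have le0 : 0 < lnorm f x e by rewrite sqrtr_gt0; exact: pd.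
pose B := (nu + kappa + 1 + nu / 1) / (1 - kappa).
have n0 : 0 <= nu by apply: (nu_ge0 scb); exists x.
have B0 : 0 <= B.
  by apply: divr_ge0; [rewrite divr1 !addr_ge0|rewrite subr_ge0 ltW].
apply: (@nu_ge1 _ _ _ _ _ _ scb x (((B + 1) / lnorm f x e) *: e) Dx) => Du.
have := domain_bounded scb k0 k1 ltr01 Dx Du gk.
rewrite lnormZ ger0_norm; last by rewrite divr_ge0 ?addr_ge0 // ltW.
rewrite divfK ?gt_eqF // -/B leNgt => /negP; apply.
by rewrite ltrDl.
Qed.

Lemma D_sub_interior : D `<=` interior X.
Proof.
move=> x Dx; have := open_nbhs_nbhs (conj (scb_open scb) Dx).
apply: filterS => y Dy; rewrite -(scb_closure scb).
exact: subset_closure.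
Qed.

(* On a ray f tends to -oo under logarithmic homogeneity, so the existence of an
   analytical center leaves only the case n_nu = nu + 2 sqrt nu. *)
Lemma not_log_homogeneous x0 : D x0 -> 0 < nu ->
  (exists xf, interior X xf /\ forall y, interior X y -> f xf <= f y) ->
  ~ log_homogeneous nu D f.
Proof.
move=> Dx0 n0 [xf [_ fmin]] lh.
(* Scaling [x0] by [expR a] lowers [f] to [f xf - 1]. *)
pose a := (f x0 - f xf + 1) / nu.
have [Dt e] := lh x0 (expR a) Dx0 (expR_gt0 a).
have := fmin _ (D_sub_interior Dt); rewrite e expRK.
by rewrite /a mulrC divfK ?gt_eqF //; move: (f x0) (f xf) => A B; lra.
Qed.

(* The Dikin ellipsoid at x lies in D, so the width of D controls the dual local
   norm of zeta at every x. *)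
Lemma bounded_functional x0 zeta (K B : R) : 0 <= K ->
  (forall v, `|dot zeta v| <= K * lnorm f x0 v) ->
  (forall y, D y -> lnorm f x0 (y - x0) <= B) ->
  forall x v, D x -> `|dot zeta v| <= K * B * lnorm f x v.
Proof.
move=> K0 zK DB x v Dx.
have unit w : lnorm f x w < 1 -> `|dot zeta w| <= K * B.
  move=> w1.
  have D1 := dikin scb Dx w1.
  have D2 : D (x - w) by apply: (dikin scb Dx); rewrite lnormN.
  (* Halving the difference over the symmetric points [x + w] and [x - w] avoids a factor 2 in the
     bound. *)
  have e : dot zeta w = 2^-1 * (dot zeta (x + w - x0) - dot zeta (x - w - x0)).
    rewrite !dotBr dotDr.
    by move: (dot _ _) (dot _ _) (dot _ _) => *; field.
  have b1 := le_trans (zK _) (ler_wpM2l K0 (DB _ D1)).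
  have b2 := le_trans (zK _) (ler_wpM2l K0 (DB _ D2)).
  rewrite e normrM ger0_norm ?invr_ge0 //.
  have := ler_normB (dot zeta (x + w - x0)) (dot zeta (x - w - x0)).
  move: b1 b2; move: `|_ - _| `|_| `|_| (K * B) => *; lra.
have gt b : lnorm f x v < b -> `|dot zeta v| <= K * B * b.
  move=> vb; have b0 : 0 < b by exact: le_lt_trans (lnorm_ge0 _ _ _) vb.
  have := unit (b^-1 *: v); rewrite lnormZ gtr0_norm ?invr_gt0 //.
  rewrite mulrC ltr_pdivrMr // mul1r => /(_ vb).
  by rewrite dotZr normrM gtr0_norm ?invr_gt0 // mulrC ler_pdivrMr.
have KB : 0 <= K * B by apply: le_trans (unit 0 _); rewrite ?lnorm0.
apply/ler_addgt0Pr => e e0.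
have KB1 : 0 < K * B + 1 by rewrite ltr_wpDl.
have := gt (lnorm f x v + e / (K * B + 1)).
rewrite ltrDl divr_gt0 // => /(_ isT) /le_trans; apply.
rewrite mulrDr lerD2l mulrCA ler_piMr ?(ltW e0) //.
by rewrite ler_pdivrMr // mul1r lerDl.
Qed.

End CentralPoint.

(** * The path-following iteration *)

Section PathFollowingScalars.
Context {R : realType}.

Lemma one_sub_exp_le (sg : R) n : 0 <= sg -> sg <= 1 -> (1 - sg) ^+ n <= expR (- (n%:R * sg)).
Proof.
move=> s0 s1; rewrite -mulrN mulrC expRM_natr.
apply: lerXn2r; rewrite ?nnegrE ?expR_ge0 ?subr_ge0 //.
exact: expR_ge1Dx.
Qed.

(** A test still failing at step [n] means [eps < exp(- n sigma) t0 * 100 nu]. The threshold gives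
    [100 t0 <= nu / eps], hence [n sigma < 2 ln (nu / eps)]. *)
Lemma iteration_count (beta nu eps t0 psi : R) (tt : nat -> R) n :
  0 < beta -> beta <= 1 / 9 -> 1 <= nu -> 0 < eps -> 0 < t0 -> 0 < psi -> psi <= 100 * nu ->
  expR 1 + 100 * `|t0| <= nu / eps -> tt 0%N = t0 ->
  (forall k, eps < tt k * psi -> tt k.+1 = (1 - sigma_beta beta nu) * tt k) ->
  (forall k, (k < n)%N -> eps < tt k * psi) ->
  n%:R <= (2 * (1 + c_beta beta) / c_beta beta + 1) * Num.sqrt nu * ln (nu / eps).
Proof.
move=> b0 b1 nu1 e0 t00 psi0 psile Lle tt0 ttS run.
have [sg0 [sg1 sgq]] := sigma_beta_bounds b0 b1 nu1.
have c0 := c_beta_gt0 b0 b1.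
have q1 : 1 <= Num.sqrt nu by rewrite -[leLHS]sqrtr1; apply: ler_wsqrtr.
have nu0 : 0 < nu by apply: lt_le_trans nu1.
have rho0 : 0 < nu / eps by rewrite divr_gt0.
have e1 : expR 1 <= nu / eps.
  by apply: le_trans Lle; rewrite lerDl mulr_ge0.
have e2 : 100 * t0 <= nu / eps.
  apply: le_trans Lle; rewrite gtr0_norm //.
  by rewrite lerDr expR_ge0.
have ln1 : 1 <= ln (nu / eps).
  by rewrite -[leLHS]expRK ler_ln ?posrE ?expR_gt0.
move: (ln (nu / eps)) (lnK (rho0 : nu / eps \in Num.pos)) ln1 => l lE ln1.
have q0 : 0 < Num.sqrt nu by apply: lt_le_trans q1.
have c1 : 0 < 1 + c_beta beta by rewrite addr_gt0.
have ql1 : 1 <= Num.sqrt nu * l by apply: mulr_ege1.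
have cc0 : 0 <= 2 * (1 + c_beta beta) / c_beta beta.
  by apply: divr_ge0; [apply: mulr_ge0; rewrite // ltW|exact: ltW].
rewrite -mulrA mulrDl mul1r.
(* For [n.+1] running steps the last failing test has index [n]. The missing unit is the [+ 1] of
   the constant, since [sqrt nu * l >= 1]. *)
case: n run => [|n] run.
  by apply: addr_ge0; [apply: mulr_ge0 => //|]; exact: le_trans ql1.
have ttn k : (k <= n)%N -> tt k = (1 - sigma_beta beta nu) ^+ k * t0.
  elim: k => [|k IH] kn; first by rewrite tt0 mul1r.
  by rewrite (ttS k (run k (ltnW kn))) (IH (ltnW kn)) exprS mulrA.
have := run n (ltnSn n); rewrite ttn // => h.
have h1 : eps < expR (- (n%:R * sigma_beta beta nu)) * t0 * (100 * nu).
  apply: (lt_le_trans h); apply: ler_pM => //.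
  - by apply: mulr_ge0; [apply: exprn_ge0; rewrite subr_ge0|]; exact: ltW.
  - exact: ltW.
  - by apply: ler_wpM2r; [|apply: one_sub_exp_le]; exact: ltW.
have h2 : expR (n%:R * sigma_beta beta nu) < expR (l * 2).
  have h3 : expR (n%:R * sigma_beta beta nu) * eps < t0 * (100 * nu).
    by move: h1; rewrite expRN -!mulrA ltr_pdivlMl ?expR_gt0.
  have h4 : expR (n%:R * sigma_beta beta nu) < 100 * t0 * (nu / eps).
    by rewrite mulrA ltr_pdivlMr // (mulrC 100 t0) -mulrA.
  apply: (lt_le_trans h4); rewrite expRM_natr lE expr2.
  by apply: ler_wpM2r => //; exact: ltW.
rewrite ltr_expR in h2.
have h5 : n%:R <= 2 * (1 + c_beta beta) / c_beta beta * (Num.sqrt nu * l).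
  have -> : 2 * (1 + c_beta beta) / c_beta beta * (Num.sqrt nu * l)
     = (l * 2) / sigma_beta beta nu.
    by rewrite /sigma_beta; field; rewrite !gt_eqF.
  by rewrite ler_pdivlMr // ltW.
by rewrite -natr1; apply: lerD.
Qed.

Lemma step_value_le (r rz t P q e V d : R) : 0 <= t * q ->
  r - rz <= t * (e + V - (V + P + 2^-1 * q)) ->
  r + (d - - t * P) - t * e <= rz + d.
Proof. lra. Qed.

Lemma gap_value_le (r t A e psi : R) : t * (A + e) <= t * psi ->
  r - t * psi <= r + - t * A - t * e.
Proof. lra. Qed.

Lemma scaled_delta_le (beta : R) : 0 < beta -> 4 / 3 * delta beta <= 9 / 100 * beta.
Proof. rewrite /delta; lra. Qed.

Lemma residual_dot_opp (t a b d e : R) : 0 < t ->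
  a = - t * (b + (- (t^-1 * a + (b - e) + d) + (d - e))).
Proof. by move=> t0; field; rewrite gt_eqF. Qed.

End PathFollowingScalars.

Section PathFollowing.
Context {R : realType} {p : nat}.
Context (nu : R) (X D : set 'rV[R]_p) (f : 'rV[R]_p -> R).
Context (scb : self_concordant_barrier nu X D f).
Context (c : 'rV[R]_p) (g : 'rV[R]_p -> \bar R).
Context (pg : proper g) (cg : convex_set (epigraph g)) (gdom : edom g !=set0).
Context (beta : R) (beta0 : 0 < beta) (beta1 : beta <= 1 / 9) (nu1 : 1 <= nu).
Context (zeta : 'rV[R]_p) (M : R) (M0 : 0 <= M) (M1 : M <= 173 / 500).
Context (zetaM : forall x v, D x -> `|dot zeta v| <= M * lnorm f x v).
Implicit Types (x y z u v w xi : 'rV[R]_p) (s t r : R).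

(* The exact subproblem solution z carries a subgradient xi for which x almost
   solves the linearised optimality condition; the last clause says that xi is
   an approximate subgradient at x itself. The constants 9/100 and 9/10 reproduce
   themselves under a Newton step and add up to less than beta, the slack that
   psi_beta leaves for them. *)
Definition near_path t x : Prop :=
  D x /\ exists z xi, [/\ objective_subgradient c g z xi,
    lnorm f x (z - x) <= 9 / 100 * beta,
    forall v, `|dot (residual f zeta t x z xi) v| <= 9 / 10 * beta * lnorm f x v &
    exists2 r, objective c g x = r%:E & forall y,
      ((r + dot xi (y - x) - t * (delta beta ^+ 2 / 2))%:E <= objective c g y)%E].

(** [newton_distance] and [step_bound] give the length of the step, and [newton_residual] then
    restores the invariant at [x']. *)
Lemma near_path_step t x x' : 0 < t -> near_path t x ->
  delta_solution f c g X (delta beta) 1 zeta ((1 - sigma_beta beta nu) * t) x x' ->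
  near_path ((1 - sigma_beta beta nu) * t) x'.
Proof.
move=> t0 [Dx [z [xi [sz zx rE _]]]] [_ [z' [zmin x'z val]]].
have [sg0 [sg1 _]] := sigma_beta_bounds beta0 beta1 nu1.
set t' := (1 - sigma_beta beta nu) * t in zmin val *.
have t'0 : 0 < t' by rewrite mulr_gt0 // subr_gt0.
have [xi' sz' r0] := subproblem_subgradient pg cg scb Dx t'0 gdom zmin.
have mono := objective_subgradient_monotone sz sz'.
have E0 : 0 <= 9 / 10 * beta by apply: mulr_ge0; [lra|exact: ltW].
have d0 : 0 <= 9 / 100 * beta by apply: mulr_ge0; [lra|exact: ltW].
have zM v : `|dot zeta v| <= M * lnorm f x v := zetaM v Dx.
have dist := newton_distance scb Dx t0 (ltW sg0) sg1 M0 E0 d0 zM rE zx r0 mono.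
have [mu1 mu2] := step_bound beta0 beta1 nu1 M0 M1 (lnorm_ge0 f x _) dist.
set mu := _ + _ + _ in mu1 mu2.
have xmu : lnorm f x (x' - x) <= mu.
  have -> : x' - x = (z' - z) + (z - x) + (x' - z').
    by rewrite (addrA (z' - z)) subrK [RHS]addrC addrA subrK.
  apply: (le_trans (lnormD scb _ _ Dx)); apply: lerD => //.
  by apply: (le_trans (lnormD scb _ _ Dx)); apply: lerD.
have z'x' : lnorm f x (z' - x') <= delta beta by rewrite -opprB lnormN.
have [Dx' dx' res] := newton_residual scb Dx xmu mu1 z'x' r0.
split; first exact: Dx'.
exists z', xi'; split; first exact: sz'.
- exact: le_trans dx' (scaled_delta_le beta0).
- move=> v; apply: (le_trans (res v)).
  by apply: ler_wpM2r => //; exact: lnorm_ge0.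
(* For the last clause, the subgradient inequality at [z'] is moved to [x'] by the value bound of
   the inexact solution; the quadratic term in [x' - z'] is nonnegative and dropped. *)
have [rz ez hz] := sz'.
have [r er hr] := subproblem_value_le pg t'0 ez val.
exists r => // y; apply: le_trans (hz y).
rewrite lee_fin.
have md := modelD scb zeta z' (x' - z') Dx.
rewrite addrC subrK in md.
have xiE : dot xi' (x' - z') = - t' * dot (grad f x - zeta + (z' - x) *m hess f x) (x' - z').
  have := residual_dot f zeta t' x z' xi' (x' - z'); rewrite r0 dotC dot0r.
  rewrite dotDl dotBl -addrA => /eqP; rewrite eq_sym addrC addr_eq0 => /eqP ->.
  by rewrite mulrNN mulrA divff ?mul1r // gt_eqF.
have q0 : 0 <= dot ((x' - z') *m hess f x) (x' - z') := hess_ge0 scb _ Dx.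
have -> : dot xi' (y - x') = dot xi' (y - z') - dot xi' (x' - z').
  by rewrite -dotBr opprB addrA subrK.
move: hr; rewrite md xiE => hr.
exact: (step_value_le _ (mulr_ge0 (ltW t'0) q0) hr).
Qed.

(** Solving the residual for [xi] gives [xi = - t (grad f x + w)] with [w] of dual norm at most
    [F < 1], the situation of [perturbed_grad_le]. *)
Lemma near_path_gap (m : R) t x : 0 <= m -> m < (1 - beta) / (3 + beta) ->
  M <= m + m ^+ 2 / 9 -> 0 < t -> near_path t x ->
  exists2 r, objective c g x = r%:E & forall y, X y ->
    ((r - t * psi_beta beta m nu)%:E <= objective c g y)%E.
Proof.
move=> m0 m1 Mm t0 [Dx [z [xi [_ zx rE [r er hr]]]]].
exists r => // y Xy; apply: le_trans (hr y); rewrite lee_fin.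
pose w := - residual f zeta t x z xi + ((z - x) *m hess f x - zeta).
(* The contributions of the residual, of [z - x] and of [zeta]; the first two sum to less than
   [beta]. *)
pose F := 9 / 10 * beta + (9 / 100 * beta + M).
have wF v : `|dot w v| <= F * lnorm f x v.
  rewrite /w dotDl dotNl dotBl /F (mulrDl (9 / 10 * beta)) (mulrDl (9 / 100 * beta)).
  apply: (le_trans (ler_normD _ _)).
  rewrite normrN; apply: lerD; first exact: rE.
  apply: (le_trans (ler_normB _ _)).
  apply: lerD; last exact: zetaM.
  apply: (le_trans (hess_cs scb _ _ Dx)); apply: ler_wpM2r => //; exact: lnorm_ge0.
have F0 : 0 <= F by rewrite /F; move: beta0 M0 => ? ?; lra.
have Fle : F <= m + m ^+ 2 + beta.
  by have := sqr_ge0 m; rewrite /F; move: beta0 Mm => ? ?; lra.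
have [F1 psile] := psi_beta_ge beta0 beta1 m0 m1 nu1 F0 Fle.
have xiE : dot xi (y - x) = - t * dot (grad f x + w) (y - x).
  rewrite dotDl /w dotDl dotNl residual_dot dotBl.
  exact: residual_dot_opp.
have bound : dot (grad f x + w) (y - x) <= nu + Num.sqrt nu * (F / (1 - F)).
  apply: (closure_dot_le (D := D)); last by rewrite (scb_closure scb).
  move=> y' Dy'; apply: (perturbed_grad_le scb nu1 F0 F1 Dx _ wF).
  by rewrite addrC subrK.
rewrite xiE; apply: gap_value_le.
exact: (ler_wpM2l (ltW t0) (le_trans (lerD bound (lexx _)) psile)).
Qed.

End PathFollowing.

(** * Initialization and the iteration bound *)

Lemma near_path_init (R : realType) (p : nat) (D : set 'rV[R]_p) (f : 'rV[R]_p -> R)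
    (c : 'rV[R]_p) (g : 'rV[R]_p -> \bar R) (beta t : R) (x xi : 'rV[R]_p) :
  0 < beta -> 0 < t -> D x -> objective_subgradient c g x xi ->
  near_path D f c g beta (grad f x + t^-1 *: xi) t x.
Proof.
move=> b0 t0 Dx sx; split; first exact: Dx.
have [r er hr] := sx.
exists x, xi; split; first exact: sx.
- rewrite subrr lnorm0; apply: mulr_ge0; last exact: ltW.
  by apply: divr_ge0; rewrite ler0n.
- move=> v; have -> : residual f (grad f x + t^-1 *: xi) t x x xi = 0.
    by rewrite /residual subrr mul0mx addr0 opprD addNKr subrr.
  rewrite dotC dot0r normr0; apply: mulr_ge0; last exact: lnorm_ge0.
  by apply: mulr_ge0; [apply: divr_ge0; rewrite ler0n|exact: ltW].
exists r => // y; apply: le_trans (hr y); rewrite lee_fin gerBl.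
by apply: mulr_ge0; [exact: ltW|apply: divr_ge0; [exact: sqr_ge0|rewrite ler0n]].
Qed.

(** The O-notation is rendered by a constant [C] that depends on [beta] only and a threshold [L] on
    [nu / eps] that depends on [t0] only. [N] is the first index at which the stopping test
    holds. *)
Theorem theorem1 (R : realType) (beta : R) (hbeta0 : 0 < beta)
    (hbeta1 : beta <= 1 / 9) :
  exists2 C : R, 0 < C & forall t0 : R, exists L : R,
  forall (p : nat) (c : 'rV[R]_p) (g : 'rV[R]_p -> \bar R)
    (X D : set 'rV[R]_p) (f : 'rV[R]_p -> R) (nu eps : R)
    (x0 xi0 : 'rV[R]_p) (kappa : R)
    (tt : nat -> R) (xx : nat -> 'rV[R]_p),
  let nn := n_nu nu D f in
  let c0 := dual_lnorm f x0 (c + xi0) in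
  let m := m_hat nn kappa t0 c0 in
  let psi := psi_beta beta m nu in
  let zeta0 := grad f x0 + t0^-1 *: (c + xi0) in
  (0 < p)%N ->
  proper g -> closed_convex g ->
  closed X -> convex_set X -> interior X !=set0 ->
  X `&` edom g !=set0 ->
  (exists xs, minimizer_on X (objective c g) xs) ->
  self_concordant_barrier nu X D f ->
  (exists xf, interior X xf /\ forall y, interior X y -> f xf <= f y) ->
  D x0 -> positive_definite (hess f x0) ->
  0 < kappa -> kappa < kappa_max beta nn ->
  dual_lnorm f x0 (grad f x0) <= kappa ->
  subdifferential g x0 xi0 ->
  (1 - beta) * c0 / ((3 + beta) * nn) < t0 ->
  m < (1 - beta) / (3 + beta) ->
  0 < eps -> L <= nu / eps ->
  path_following_run f c g X eps beta psi (sigma_beta beta nu) 1 zeta0 x0 t0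
    tt xx ->
  exists N : nat,
    [/\ N%:R <= C * Num.sqrt nu * ln (nu / eps),
        forall k, (k < N)%N -> eps < tt k * psi,
        tt N * psi <= eps
      & eps_solution c g X eps (xx N)].
Proof.
have cb0 := c_beta_gt0 hbeta0 hbeta1.
exists (2 * (1 + c_beta beta) / c_beta beta + 1).
  apply: addr_gt0 ltr01; apply: divr_gt0 => //.
  by apply: mulr_gt0 => //; exact: addr_gt0.
(* The first summand makes the logarithm at least 1, the second absorbs [t0] and the factor of
   [psi <= 100 nu]. *)
move=> t0; exists (expR 1 + 100 * `|t0|).
move=> p c g X D f nu eps x0 xi0 kappa tt xx nn c0 m psi zeta0.
move=> p0 pg [_ cg] _ _ _ [yg [_ gy]] _ scb center Dx0 pd k0 kmax gk0 sub0 t0gt m1 e0 Lle.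
move=> [tt0 xx0 run].
have k12 : kappa < 1 / 2 := lt_le_trans kmax (kappa_max_le _ _).
have k1 : kappa < 1 by lra.
have gk v : `|dot (grad f x0) v| <= kappa * lnorm f x0 v.
  apply: (le_trans (dual_lnorm_cs scb _ _ Dx0 pd)).
  by apply: ler_wpM2r => //; exact: lnorm_ge0.
have nu1 := nu_ge1_of_positive_definite scb p0 Dx0 pd (ltW k0) k1 gk.
have nu0 : 0 < nu := lt_le_trans ltr01 nu1.
have q1 : 1 <= Num.sqrt nu by rewrite -[leLHS]sqrtr1; apply: ler_wsqrtr.
have qq : Num.sqrt nu * Num.sqrt nu = nu by rewrite -expr2 sqr_sqrtr // ltW.
have nnE : nn = nu + 2 * Num.sqrt nu.
  rewrite /nn /n_nu; case: asboolP => // lh.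
  by have := not_log_homogeneous scb Dx0 nu0 center lh.
have nn3 : 3 <= nn by rewrite nnE; lra.
have c00 : 0 <= c0 by exact: sqrtr_ge0.
have t00 : 0 < t0.
  apply: le_lt_trans t0gt; apply: divr_ge0; apply: mulr_ge0 => //; lra.
have ti0 : 0 <= t0^-1 by rewrite invr_ge0 ltW.
pose q := kappa + t0^-1 * c0.
have qk : kappa <= q by rewrite lerDl mulr_ge0.
have q0 : 0 <= q by apply: le_trans qk; exact: ltW.
have zq v : `|dot zeta0 v| <= q * lnorm f x0 v.
  rewrite dotDl dotZl mulrDl; apply: (le_trans (ler_normD _ _)).
  apply: lerD; first exact: gk.
  rewrite normrM ger0_norm // -mulrA; apply: ler_wpM2l => //.
  exact: (dual_lnorm_cs scb _ _ Dx0 pd).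
pose B := (nn + kappa) / (1 - kappa).
(* [domain_bounded] with [z = sqrt nu], where [nu / z = sqrt nu] produces the constant [nn]. *)
have DB y : D y -> lnorm f x0 (y - x0) <= B.
  move=> Dy; have s0 : 0 < Num.sqrt nu := lt_le_trans ltr01 q1.
  have Dy' : D (x0 + (y - x0)) by rewrite addrC subrK.
  have := domain_bounded scb (ltW k0) k1 s0 Dx0 Dy' gk.
  rewrite -[X in X / Num.sqrt nu]qq mulfK ?gt_eqF // /B nnE.
  move/le_trans; apply; rewrite ler_pM2r ?invr_gt0 ?subr_gt0 //.
  by rewrite le_eqVlt; apply/orP; left; apply/eqP; ring.
have zM x v : D x -> `|dot zeta0 v| <= q * B * lnorm f x v.
  by move=> Dx; apply: (bounded_functional scb q0 zq DB).
have Mm : q * B <= m + m ^+ 2 / 9.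
  by apply: (center_radius_le nn3 k0 k12 qk).
have k2 : 0 < 1 - 2 * kappa by lra.
have m0 : 0 <= m.
  apply: divr_ge0; last exact: ltW.
  by apply: mulr_ge0; [lra|apply: mulr_ge0; [lra|exact: q0]].
have m3 := m_lt_third hbeta0 hbeta1 m1.
have M0 : 0 <= q * B.
  by apply: mulr_ge0 => //; apply: divr_ge0; lra.
(* From [m < 1/3]: [1/3 + 1/81 < 173/500]. *)
have M1 : q * B <= 173 / 500.
  have : m ^+ 2 <= (1 / 3) ^+ 2 by apply: lerXn2r; rewrite ?nnegrE; lra.
  lra.
have gdom : edom g !=set0 by exists yg.
have [sg0 [sg1 _]] := sigma_beta_bounds hbeta0 hbeta1 nu1.
have psile : psi <= 100 * nu := psi_beta_le hbeta0 hbeta1 m0 m1 nu1.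
have psi0 : 0 < psi.
  have F0 : 0 <= m + m ^+ 2 + beta by have := sqr_ge0 m; lra.
  have [F1 h] := psi_beta_ge hbeta0 hbeta1 m0 m1 nu1 (lexx 0) F0.
  apply: lt_le_trans h; rewrite mul0r mulr0 addr0.
  by apply: ltr_pwDl => //; apply: divr_ge0 => //; exact: sqr_ge0.
have ttS k : eps < tt k * psi -> tt k.+1 = (1 - sigma_beta beta nu) * tt k.
  by move=> /run [].
have count n := @iteration_count _ beta nu eps t0 psi tt n
  hbeta0 hbeta1 nu1 e0 t00 psi0 psile Lle tt0 ttS.
(* If the test never held, [count] would bound every natural number. *)
have ex : exists n, tt n * psi <= eps.
  apply: contrapT => nex.
  have all k : eps < tt k * psi by rewrite ltNge; apply/negP => h; apply: nex; exists k.
  set b := (2 * _ / _ + 1) * _ * _ in count.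
  have := count (Num.truncn b).+1 (fun k _ => all k).
  rewrite leNgt => /negP; apply.
  exact: truncnS_gt.
have [N stop least] := ex_minnP ex.
have running k : (k < N)%N -> eps < tt k * psi.
  by move=> kN; rewrite ltNge; apply/negP => /least; rewrite leqNgt kN.
have inv k : (k <= N)%N -> 0 < tt k /\ near_path D f c g beta zeta0 (tt k) (xx k).
  elim: k => [_|k IH kN].
    rewrite tt0 xx0; split=> //; apply: near_path_init => //.
    exact: subdifferential_objective.
  have [tk near] := IH (ltnW kN).
  have [tS dsol] := run k (running k kN).
  rewrite tS in dsol *; split; first by rewrite mulr_gt0 // subr_gt0.
  exact: (near_path_step scb pg cg gdom hbeta0 hbeta1 nu1 M0 M1 zM tk near dsol).
exists N; split=> //; first exact: count.
have [tN near] := inv N (leqnn N).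
have [r er gap] := near_path_gap scb hbeta0 hbeta1 nu1 M0 zM m0 m1 Mm tN near.
have XN : X (xx N).
  by rewrite -(scb_closure scb); apply: subset_closure; case: near.
split=> //; have : ((r - tt N * psi)%:E <= optimal_value c g X)%E.
  by apply: le_ereal_inf_tmp => _ [y Xy <-]; exact: gap.
rewrite er; case: (optimal_value c g X) => [a| |]; last by rewrite leeNy_eq.
  by rewrite -EFinB !lee_fin; move: stop; move: (_ * psi) => b; lra.
by rewrite leNye.
Qed.
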